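(* Let $b=\infty$ and $q(x)=q_0$ for all $x\ge0$, where $q_0$ is a real constant, and let $A$ be the associated $A$-amplitude. If $q_0>0$, then $$A(\alpha)=\frac{q_0^{1/2}}{\alpha}J_1(2\alpha q_0^{1/2}),$$ where $J_1$ is the Bessel function of order one; and if $q_0<0$, then $$A(\alpha)=-\frac{(-q_0)^{1/2}}{\alpha}I_1(2\alpha(-q_0)^{1/2}),$$ where $I_1$ is the modified Bessel function of order one.
   Context: For $\operatorname{Im}z>0$, $m(z)=u'(0_+,z)/u(0_+,z)$, where $u(\cdot,z)$ is the (unique up to constants) nonzero solution of $-u''+qu=zu$ on $(0,\infty)$ that is square integrable near $\infty$. $A$-amplitude: the (unique) function $A$ on $[0,\infty)$ with $A\in L^1((0,a))$ for all $a<\infty$ such that for all $a>0$, $\varepsilon>0$, $m(-\kappa^2)=-\kappa-\int_0^aA(\alpha)e^{-2\alpha\kappa}d\alpha+\tilde O(e^{-2a\kappa})$ as $|\kappa|\to\infty$ with $-\frac\pi2+\varepsilon<\arg\kappa<-\varepsilon$, where $f=\tilde O(g)$ means $g\to0$ and $(f/g)|g|^\eta\to0$ for all $\eta>0$. $A-q$ is continuous, which fixes the pointwise values of $A$. *)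

(* Defs.v *)
From HB Require Import structures.
From mathcomp Require Import all_boot all_order all_algebra.
From mathcomp Require Import all_classical all_reals all_analysis.
From mathcomp.real_closed Require Import complex.
Set Implicit Arguments.
Unset Strict Implicit.
Unset Printing Implicit Defensive.
Import Order.TTheory GRing.Theory Num.Theory.
Import Normc numFieldNormedType.Exports.
Local Open Scope classical_set_scope.
Local Open Scope ring_scope.
Local Open Scope complex_scope.

(* R[i] itself carries no topology in the libraries; limits in R[i] are taken
   in the regular module R[i]^o, whose topology is that of the modulus. *)

Section ComplexAnalysis.
Variable R : realType.
Implicit Types (u : R -> R[i]) (f g : R[i] -> R[i]).

Definition cexp (w : R[i]) : R[i] :=
  (expR (complex.Re w) * cos (complex.Im w))
  +i* (expR (complex.Re w) * sin (complex.Im w)).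

Definition cderivable u (x : R) : Prop :=
  derivable (fun t => complex.Re (u t)) x 1 /\
  derivable (fun t => complex.Im (u t)) x 1.

Definition cderive u (x : R) : R[i] :=
  (derive1 (fun t => complex.Re (u t)) x)
  +i* (derive1 (fun t => complex.Im (u t)) x).

Definition cintegral (a b : R) u : R[i] :=
  (\int[lebesgue_measure]_(t in `]a, b[) complex.Re (u t))%R
  +i* (\int[lebesgue_measure]_(t in `]a, b[) complex.Im (u t))%R.

(* the filter of neighbourhoods of infinity: |kappa| -> oo *)
Definition cinfty : set_system R[i] :=
  [set P | exists M : R, forall k : R[i], M < normc k -> P k].

Global Instance cinfty_filter : Filter cinfty.
Proof.
split.
- by exists 0.
- move=> P Q [M hM] [N hN]; exists (Num.max M N) => k.
  by rewrite gt_max => /andP[? ?]; split; [exact: hM | exact: hN].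
- by move=> P Q PQ [M hM]; exists M => k /hM /PQ.
Qed.

(* { kappa <> 0 : -pi/2 + e < arg kappa < -e } *)
Definition sector (e : R) : set R[i] :=
  [set k | exists r t : R,
    [/\ 0 < r, - (pi / 2) + e < t, t < - e & k = r%:C * (cos t +i* sin t)]].

Definition tildeO (F : set_system R[i]) f g : Prop :=
  g k @[k --> F] --> (0 : R[i]^o) /\
  forall eta : R, 0 < eta ->
    f k / g k * (normc (g k) `^ eta)%:C @[k --> F] --> (0 : R[i]^o).

End ComplexAnalysis.

Section AAmplitude.
Variable R : realType.
Implicit Types (q A : R -> R) (z : R[i]) (u : R -> R[i]).

(* Nonzero solution of -u'' + q u = z u on (0, oo) which is square integrable
   near infinity. The equation holds pointwise, the appropriate notion for
   continuous q; for a q that is merely locally integrable one would ask that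
   u and u' be locally absolutely continuous and the equation hold a.e. *)
Definition weyl_solution q z u : Prop :=
  [/\ forall x : R, 0 < x -> cderivable u x /\ cderivable (cderive u) x,
      forall x : R, 0 < x ->
        - cderive (cderive u) x + (q x)%:C * u x = z * u x,
      exists2 x : R, 0 < x & u x != 0
    & exists2 c : R, 0 < c &
        lebesgue_measure.-integrable `[c, +oo[
          (fun x : R => ((normc (u x)) ^+ 2)%:E)].

(* m(z) = u'(0+, z) / u(0+, z); the default value 0 is only taken when no Weyl
   solution exists. *)
Definition weyl_m q z : R[i] :=
  xget 0 [set w | exists u, weyl_solution q z u /\
    exists u0 u1 : R[i]^o,
      [/\ u x @[x --> 0^'+] --> u0, cderive u x @[x --> 0^'+] --> u1,
          u0 != 0 & w = u1 / u0]].

Definition is_A_amplitude q A : Prop :=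
  [/\ forall a : R, 0 < a ->
        lebesgue_measure.-integrable `]0, a[ (EFin \o A),
      forall a e : R, 0 < a -> 0 < e ->
        tildeO (within (sector e) (@cinfty R))
          (fun k => weyl_m q (- k ^+ 2) -
             (- k - cintegral 0 a
                (fun t : R => (A t)%:C * cexp (- (2 * t)%:C * k))))
          (fun k => cexp (- (2 * a)%:C * k))
    & {within `[0, +oo[, continuous (fun x : R => A x - q x)}].

End AAmplitude.

Section Bessel.
Variable R : realType.

Definition besselJ (n : nat) (x : R) : R :=
  limn (series (fun k : nat =>
    (-1) ^+ k / (k`! * (k + n)`!)%:R * (x / 2) ^+ (2 * k + n))).

Definition besselI (n : nat) (x : R) : R :=
  limn (series (fun k : nat =>
    (k`! * (k + n)`!)%:R^-1 * (x / 2) ^+ (2 * k + n))).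

End Bessel.

(* Main.v *)
Require Import Defs.
From HB Require Import structures.
From mathcomp Require Import all_boot all_order all_algebra.
From mathcomp Require Import all_classical all_reals all_analysis measurable_realfun.
From mathcomp.real_closed Require Import complex.
From mathcomp Require Import cyclic cyclotomic separable ring lra.
Import Order.TTheory GRing.Theory Num.Theory.
Import Normc numFieldNormedType.Exports.
Local Open Scope classical_set_scope.
Local Open Scope ring_scope.
Local Open Scope complex_scope.
Local Notation Re := complex.Re.
Local Notation Im := complex.Im.
Set Implicit Arguments.
Unset Strict Implicit.
Unset Printing Implicit Defensive.

(* For a constant potential the Weyl solution at energy -k^2 is exp(- s x) with
   s^2 = k^2 + q0 and Re s > 0, so m(-k^2) = - s.  The candidate
   F(t) = sum_j (-1)^j q0^(j+1) t^(2j) / (j! (j+1)!) has Laplace transform s - k: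
   integrating term by term gives a Catalan generating series, hence the small
   root of w^2 + 2 k w = q0, and cutting the integral at a costs O(exp(- 2 a k)).
   Therefore b = A - F satisfies
     | int_0^a b(t) exp(2 (a - t) k) dt | <= exp(eta |k|)
   for every eta > 0 and large k in each sector -pi/2 + e < arg k < - e, and in
   the conjugate sectors because b is real.  The maximum principle on circles
   centred at r > 0, applied after multiplication by a power of 1 - w^2 that
   kills the two real points of the circle, extends the bound to the positive
   real axis.  There a Mikusinski-type argument applies: combining the moments at
   the integer multiples of k into 1 - (1 - u / N)^N with u = exp(2 k (y - t))
   approximates the indicator of t < y, so int_0^y b = 0 for all y and b = 0. *)

(** * Complex numbers and complex-valued functions of a real variable *)

Section ComplexNumbers.
Variable R : realType.
Implicit Types (x y t : R) (z w : R[i]).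

(** The obstacle is that the defining asymptotics hold only in sectors away from the positive real
    axis, with thresholds that depend on the opening, while the uniqueness argument samples real
    points. On the arcs of a circle close to the axis only the trivial bound, of order exp(2 a Re
    k), is available; a weight whose exponent grows linearly with the radius absorbs it there and
    costs at most exp(delta r) elsewhere. The maximum principle comes from averaging polynomials
    over roots of unity, with the entire function replaced by its Taylor polynomials. The final
    argument tolerates subexponential growth because testing at y < a leaves a factor exp(- 2 k (a -
    y)) in hand; this is why constant factors may be lost freely along the way. *)

Lemma Re_add z w : Re (z + w) = Re z + Re w. Proof. by case: z w => [? ?] []. Qed.
Lemma Im_add z w : Im (z + w) = Im z + Im w. Proof. by case: z w => [? ?] []. Qed.
Lemma Re_opp z : Re (- z) = - Re z. Proof. by case: z. Qed.
Lemma Im_opp z : Im (- z) = - Im z. Proof. by case: z. Qed.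
Lemma Re_mul z w : Re (z * w) = Re z * Re w - Im z * Im w.
Proof. by case: z w => [? ?] []. Qed.
Lemma Im_mul z w : Im (z * w) = Re z * Im w + Im z * Re w.
Proof. by case: z w => [? ?] []. Qed.

Definition ReImE := (Re_add, Im_add, Re_opp, Im_opp, Re_mul, Im_mul).

Lemma complex_ext z w : Re z = Re w -> Im z = Im w -> z = w.
Proof. by case: z w => [? ?] [? ?] /= -> ->. Qed.

Lemma normc_sqr z : normc z ^+ 2 = Re z ^+ 2 + Im z ^+ 2.
Proof. by case: z => a b /=; rewrite sqr_sqrtr// addr_ge0 ?sqr_ge0. Qed.

Lemma normc_ge0 z : 0 <= normc z.
Proof. by case: z => a b /=; exact: sqrtr_ge0. Qed.

Lemma normcR x : normc x%:C = `|x|.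
Proof. by rewrite /= expr0n addr0 sqrtr_sqr. Qed.

Lemma normc_le_normRe_normIm z : normc z <= `|Re z| + `|Im z|.
Proof.
rewrite -(ler_sqr (x := normc z)) ?nnegrE ?normc_ge0 ?addr_ge0//.
rewrite normc_sqr sqrrD !real_normK ?num_real// -addrA lerD2l lerDr.
by rewrite mulrn_wge0// mulr_ge0.
Qed.

Lemma normRe_le_normc z : `|Re z| <= normc z.
Proof.
rewrite -(ler_sqr (x := `|_|)) ?nnegrE ?normc_ge0//.
by rewrite normc_sqr real_normK ?num_real// lerDl sqr_ge0.
Qed.

Lemma normIm_le_normc z : `|Im z| <= normc z.
Proof.
rewrite -(ler_sqr (x := `|_|)) ?nnegrE ?normc_ge0//.
by rewrite normc_sqr real_normK ?num_real// lerDr sqr_ge0.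
Qed.

Lemma normc_sum I (r : seq I) (P : pred I) (F : I -> R[i]) :
  normc (\sum_(i <- r | P i) F i) <= \sum_(i <- r | P i) normc (F i).
Proof.
elim/big_ind2 : _ => [|x1 x2 y1 y2 h1 h2|//]; first by rewrite normc0.
exact: le_trans (le_normcD _ _) (lerD _ _).
Qed.

Lemma normcX z n : normc (z ^+ n) = normc z ^+ n.
Proof. by elim: n => [|n ih]; rewrite ?expr0 ?normc1// !exprS normcM ih. Qed.

Lemma normc_eq0 z : (normc z == 0) = (z == 0).
Proof. by apply/eqP/eqP => [/eq0_normc//|->]; rewrite normc0. Qed.

Lemma normc_gt0 z : (0 < normc z) = (z != 0).
Proof. by rewrite lt_def normc_eq0 normc_ge0 andbT. Qed.

Lemma normc_distC z w : normc (z - w) = normc (w - z).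
Proof. by rewrite -normcN opprB. Qed.

Lemma le_normc_sub z w : normc (z - w) <= normc z + normc w.
Proof. by rewrite -(normcN w) le_normcD. Qed.

Lemma normc_natr n : normc (n%:R : R[i]) = n%:R.
Proof.
have -> : (n%:R : R[i]) = (n%:R : R)%:C by rewrite rmorph_nat.
by rewrite normcR ger0_norm.
Qed.

Lemma normc_unit z n : (0 < n)%N -> z ^+ n = 1 -> normc z = 1.
Proof.
move=> n0 zn; apply/eqP; rewrite -(pexpr_eq1 n0 (normc_ge0 z)) -normcX zn.
by rewrite normc1.
Qed.

Lemma cexpD z w : cexp (z + w) = cexp z * cexp w.
Proof.
by apply: complex_ext; rewrite {1}/cexp [in LHS]/= !ReImE expRD /cexp /= ?cosD ?sinD; ring.
Qed.

Lemma cexp0 : cexp (0 : R[i]) = 1.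
Proof. by apply: complex_ext; rewrite /cexp /= expR0 ?cos0 ?sin0 mul1r. Qed.

Lemma normc_cexp z : normc (cexp z) = expR (Re z).
Proof.
rewrite /cexp /= !exprMn -mulrDr cos2Dsin2 mulr1 sqrtr_sqr.
by rewrite ger0_norm// expR_ge0.
Qed.

Lemma cexp_neq0 z : cexp z != 0.
Proof. by rewrite -normc_gt0 normc_cexp expR_gt0. Qed.

Lemma cexp_conj z : cexp (z^*) = (cexp z)^*.
Proof. by case: z => a b; rewrite /cexp /= cosN sinN mulrN. Qed.

Lemma normc_conj z : normc (z^*) = normc z.
Proof. by case: z => a b /=; rewrite sqrrN. Qed.

(** Relational form of [cderivable] and [cderive]: it carries the value of the derivative, so that
    the rules below can be chained. *)
Definition cder (u : R -> R[i]) x z :=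
  is_derive x 1 (fun t => Re (u t)) (Re z) /\
  is_derive x 1 (fun t => Im (u t)) (Im z).

Lemma cderE u x z : cder u x z -> cderivable u x /\ cderive u x = z.
Proof.
move=> [h1 h2]; split; first by split; apply: ex_derive.
by apply: complex_ext; rewrite /cderive /= derive1E derive_val.
Qed.

Lemma cderP u x : cderivable u x -> cder u x (cderive u x).
Proof. by move=> [h1 h2]; split; apply: DeriveDef => //=; rewrite derive1E. Qed.

Lemma cder_eq u x z w : z = w -> cder u x z -> cder u x w.
Proof. by move=> ->. Qed.

Lemma is_derive_expn (n : nat) t : is_derive t 1 (fun t => t ^+ n.+1) (n.+1%:R * t ^+ n).
Proof.
rewrite (_ : (fun t => _) = (id : R -> R) ^+ n.+1).
  by apply: is_derive_eq; rewrite /GRing.scale /= mulr1.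
by apply/funext => x; rewrite exprfctE.
Qed.

Lemma cder_cst z x : cder (fun=> z) x 0.
Proof. by split => /=; exact: is_derive_cst. Qed.

Lemma cderR (f : R -> R) x df : is_derive x 1 f df -> cder (fun t => (f t)%:C) x df%:C.
Proof. by split => //=; exact: is_derive_cst. Qed.

Lemma cderD u v x z w :
  cder u x z -> cder v x w -> cder (fun t => u t + v t) x (z + w).
Proof.
move=> [? ?] [? ?]; split; rewrite ReImE.
- by under [X in is_derive _ _ X _]eq_fun do rewrite ReImE; exact: is_deriveD.
- by under [X in is_derive _ _ X _]eq_fun do rewrite ReImE; exact: is_deriveD.
Qed.

Lemma cderM u v x z w :
  cder u x z -> cder v x w -> cder (fun t => u t * v t) x (z * v x + u x * w).
Proof.
move=> [? ?] [? ?]; split; rewrite !ReImE.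
- under [X in is_derive _ _ X _]eq_fun do rewrite ReImE.
  by apply: is_derive_eq; rewrite /GRing.scale /=; ring.
- under [X in is_derive _ _ X _]eq_fun do rewrite ReImE.
  by apply: is_derive_eq; rewrite /GRing.scale /=; ring.
Qed.

Lemma cderZ u x z w : cder u x z -> cder (fun t => w * u t) x (w * z).
Proof.
by move=> h; apply: cder_eq (cderM (cder_cst w x) h); rewrite mul0r add0r.
Qed.

Lemma cder_cexp z t : cder (fun t => cexp (t%:C * z)) t (z * cexp (t%:C * z)).
Proof.
have ReZ x : Re (x%:C * z) = x * Re z by rewrite ReImE /= mul0r subr0.
have ImZ x : Im (x%:C * z) = x * Im z by rewrite ReImE /= mul0r addr0.
have ReE : (fun x => Re (cexp (x%:C * z))) =
    (fun x => expR (x * Re z) * cos (x * Im z)).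
  by apply/funext => x; rewrite -ReZ -ImZ.
have ImE : (fun x => Im (cexp (x%:C * z))) =
    (fun x => expR (x * Re z) * sin (x * Im z)).
  by apply/funext => x; rewrite -ReZ -ImZ.
split; rewrite ReImE.
- rewrite ReE; apply: is_derive_eq.
  rewrite (_ : Re (cexp _) = expR (t * Re z) * cos (t * Im z)) -?ReZ -?ImZ//.
  rewrite (_ : Im (cexp _) = expR (t * Re z) * sin (t * Im z)) -?ReZ -?ImZ//.
  by rewrite /GRing.scale /=; ring.
- rewrite ImE; apply: is_derive_eq.
  rewrite (_ : Re (cexp _) = expR (t * Re z) * cos (t * Im z)) -?ReZ -?ImZ//.
  rewrite (_ : Im (cexp _) = expR (t * Re z) * sin (t * Im z)) -?ReZ -?ImZ//.
  by rewrite /GRing.scale /=; ring.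
Qed.

Lemma cder_continuous u x z : cder u x z ->
  {for x, continuous (fun t => Re (u t))} /\ {for x, continuous (fun t => Im (u t))}.
Proof.
by move=> [h1 h2]; split; apply/differentiable_continuous/derivable1_diffP;
  exact: ex_derive.
Qed.

End ComplexNumbers.

(** * The Weyl solution for a constant potential *)

Section WeylSolutions.
Variable R : realType.
Implicit Types (x t : R) (z s : R[i]).
Local Notation mu := (@lebesgue_measure R).

Lemma normE z : `|z| = (normc z)%:C. Proof. by rewrite normc_def; case: z. Qed.

Lemma cvg_normcP {T} {F : set_system T} {FF : Filter F} (f : T -> R[i]^o)
    (l : R[i]^o) :
  f @ F --> l <-> forall e : R, 0 < e -> \forall x \near F, normc (f x - l) < e.
Proof.
split => [/cvgrPdist_lt h e e0|h].
  have e0' : 0 < e%:C by rewrite ltcR.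
  move/h : e0'; apply: filterS => x.
  by rewrite (normE (l - f x)) ltcR normc_distC.
apply/cvgrPdist_lt => e e0.
have [Ime Ree] : Im e = 0 /\ 0 < Re e by move: e0; rewrite ltcE => /andP[/eqP].
have -> : e = (Re e)%:C by apply: complex_ext.
move: (h _ Ree); apply: filterS => x.
by rewrite (normE (l - f x)) ltcR normc_distC.
Qed.

Lemma is_derive_pos_cst (f : R -> R) :
  (forall x, 0 < x -> is_derive x 1 f 0) -> forall x, 0 < x -> f x = f 1.
Proof.
move=> df.
have mon a b : 0 < a -> a < b -> f b = f a.
  move=> a0 ab; apply/eqP; rewrite -subr_eq0.
  have [||c _ ->] := @MVT _ f (fun=> 0) a b ab; last by rewrite mul0r.
  - by move=> x /[!in_itv]/= /andP[ax _]; apply: df; exact: lt_trans ax.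
  - apply: derivable_within_continuous => x /[!in_itv]/= /andP[ax _].
    by have := df _ (lt_le_trans a0 ax) => ?; exact: ex_derive.
move=> x x0; have [x1|x1|->//] := ltgtP x 1; first by rewrite (mon x 1).
by rewrite (mon 1 x).
Qed.

(** The integrating factor exp(- s x) turns [v] into a function with zero derivative on the open
    half-line. *)
Lemma cder_linear (s : R[i]) (v : R -> R[i]) :
  (forall x, 0 < x -> cder v x (s * v x)) ->
  exists c, forall x, 0 < x -> v x = c * cexp (x%:C * s).
Proof.
move=> dv; pose g x := v x * cexp (x%:C * - s).
have dg x : 0 < x -> cder g x 0.
  by move=> x0; apply: cder_eq (cderM (dv _ x0) (cder_cexp _ _)); ring.
have gE x : 0 < x -> g x = g 1.
  move=> x0; apply: complex_ext.
  - by apply: (@is_derive_pos_cst (fun x => Re (g x))) => // y /dg[].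
  - by apply: (@is_derive_pos_cst (fun x => Im (g x))) => // y /dg[].
exists (g 1) => x x0; rewrite -(gE x x0) /g -mulrA -cexpD.
by rewrite mulrN addNr cexp0 mulr1.
Qed.

Lemma square_integrable_exp (s : R) : 0 < s ->
  mu.-integrable `[1, +oo[ (fun x => (expR (- (s * x)))%:E).
Proof.
move=> s0.
have mf : measurable_fun setT (fun x : R => expR (- (s * x))).
  apply: continuous_measurable_fun => x.
  apply: continuous_comp; last exact: continuous_expR.
  by apply: continuousN; apply: continuousM; [exact: cvg_cst|exact: cvg_id].
apply/integrableP; split.
  by apply/measurable_EFinP; exact: measurable_funS mf.
under eq_integral do rewrite abse_EFin ger0_norm ?expR_ge0//.
pose G x := - (s^-1 * expR (- (s * x))).
have dG x : is_derive x 1 G (expR (- (s * x))).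
  rewrite /G; apply: is_derive_eq; rewrite /GRing.scale/=.
  by field; rewrite gt_eqF.
rewrite (@ge0_continuous_FTC2y _ (fun x => expR (- (s * x))) G 1 0).
- by rewrite -EFinB ltry.
- by move=> x _; exact: expR_ge0.
- apply: derivable_within_continuous => x _.
  have : is_derive x 1 (fun x => expR (- (s * x))) (- s * expR (- (s * x))).
    by apply: is_derive_eq; rewrite /GRing.scale/=; ring.
  by move=> ?; exact: ex_derive.
- rewrite -oppr0; apply: cvgN; rewrite -(mulr0 s^-1); apply: cvgM => //.
    exact: cvg_cst.
  apply: (@cvg_comp _ _ _ (fun x => s * x) (fun x => expR (- x)) _ +oo).
    by apply: gt0_cvgMry => //; exact: cvg_id.
  exact: cvgr_expR.
- by move=> x _; have := dG x => ?; exact: ex_derive.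
- apply: cvg_at_right_filter; apply/differentiable_continuous/derivable1_diffP.
  by have := dG 1 => ?; exact: ex_derive.
- by move=> x _; have := dG x => ?; rewrite derive1E derive_val.
Qed.

Lemma not_integrable_ge1 (f : R -> R) (c X : R) :
  (forall x, X <= x -> 1 <= f x) ->
  ~ mu.-integrable `[c, +oo[ (fun x => (f x)%:E).
Proof.
move=> f1 intf; pose Y := Num.max c X.
have : mu.-integrable `[Y, +oo[ (fun x => (f x)%:E).
  apply: integrableS intf => //; apply: subset_itvr; rewrite bnd_simp.
  by rewrite le_max lexx.
move=> /integrableP[mf]; apply/negP; rewrite -leNgt.
apply: (@le_trans _ _ (\int[mu]_(x in `[Y, +oo[) (cst 1%:E x))%E).
  rewrite integral_cst//.
  by rewrite /= lebesgue_measure_itv/= ltry mul1e.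
apply: ge0_le_integral => //.
- exact: (measurableT_comp _ mf).
- move=> /= x xY; have : (x : R) \in `[Y, +oo[ by [].
  rewrite in_itv/= andbT ge_max => /andP[_ /f1 fx].
  by rewrite lee_fin (le_trans fx)// ler_norm.
Qed.

(** The equation u'' = s^2 u factors: u' + s u and u' - s u solve first-order equations, hence equal
    c exp(s x) and d exp(- s x). Their difference 2 s u grows unless c = 0, so square integrability
    leaves u' = - s u. *)
Lemma weyl_solution_decay (q : R -> R) (q0 : R) z s (u : R -> R[i]) :
  (forall x, 0 <= x -> q x = q0) -> 0 < Re s -> s ^+ 2 = q0%:C - z ->
  weyl_solution q z u -> forall x, 0 < x -> cderive u x = - s * u x.
Proof.
move=> hq s0 sE [du eqn _ [a a0 inta]].
have s_neq0 : s != 0 by apply: contraTneq s0 => ->; rewrite ltxx.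
have uE x : 0 < x -> cderive (cderive u) x = s ^+ 2 * u x.
  move=> x0; have := eqn x x0; rewrite hq ?ltW// sE => h.
  by rewrite mulrBl -h; ring.
have dv (r : R[i]) : r ^+ 2 = s ^+ 2 -> forall x, 0 < x ->
    cder (fun x => cderive u x + r * u x) x (r * (cderive u x + r * u x)).
  move=> rs x x0; have [/cderP d1 /cderP d2] := du x x0.
  by apply: cder_eq (cderD d2 (cderZ r d1)); rewrite uE// -rs; ring.
have [c cE] := cder_linear (dv s (erefl _)).
have [d dE] := cder_linear (dv (- s) (sqrrN s)).
suff c0 : c = 0.
  by move=> x x0; have := cE x x0; rewrite c0 mul0r => /eqP;
    rewrite addr_eq0 mulNr => /eqP.
apply/eqP/negPn/negP; rewrite -normc_gt0 => c_gt0.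
have us x : 0 < x -> 2 * s * u x = c * cexp (x%:C * s) - d * cexp (x%:C * - s).
  by move=> x0; rewrite -cE// -dE//; ring.
have nus x : 0 < x -> normc c * (Re s * x) - normc d <= 2 * normc s * normc (u x).
  move=> x0.
  have -> : 2 * normc s * normc (u x) =
      normc (c * cexp (x%:C * s) - d * cexp (x%:C * - s)).
    by rewrite -us// !normcM (normc_natr R 2).
  have e1 : Re s * x <= normc (cexp (x%:C * s)).
    rewrite normc_cexp !ReImE /= mul0r subr0 [Re s * x]mulrC.
    by apply: le_trans (expR_ge1Dx _); rewrite lerDr.
  have e2 : normc (cexp (x%:C * - s)) <= 1.
    rewrite normc_cexp !ReImE /= mul0r subr0 -expR0 ler_expR mulrN oppr_le0.
    by rewrite mulr_ge0 ?ltW.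
  have := le_normcD (c * cexp (x%:C * s) - d * cexp (x%:C * - s))
    (d * cexp (x%:C * - s)).
  rewrite subrK !normcM => h.
  have h1 := ler_wpM2l (ltW c_gt0) e1.
  have h2 := ler_wpM2l (normc_ge0 d) e2.
  lra.
have ns : 0 < normc s by rewrite normc_gt0.
(* Beyond [X] the linear lower bound [nus] yields 2 |s| |u| >= 2 |s|, that is |u| >= 1. *)
pose X := (normc d + 2 * normc s) / (normc c * Re s) + 1.
have X0 : 0 < X by rewrite ltr_wpDl// divr_ge0 ?addr_ge0 ?mulr_ge0 ?normc_ge0 ?ltW.
apply: (not_integrable_ge1 (X := X)) inta => x Xx.
have x0 : 0 < x := lt_le_trans X0 Xx.
rewrite expr_ge1 ?normc_ge0// -(ler_pM2l (mulr_gt0 (ltr0Sn R 1) ns)) mulr1.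
apply: le_trans (nus x x0); rewrite lerBrDl mulrA -ler_pdivrMl ?mulr_gt0//.
by apply: le_trans Xx; rewrite /X mulrC lerDl.
Qed.

Lemma weyl_solution_exp (q : R -> R) (q0 : R) z s :
  (forall x, 0 <= x -> q x = q0) -> 0 < Re s -> s ^+ 2 = q0%:C - z ->
  weyl_solution q z (fun x => cexp (x%:C * - s)).
Proof.
move=> hq s0 sE; set u := fun x => _.
have du x := cder_cexp (- s) x.
have duE : cderive u = (fun x => - s * u x).
  by apply/funext => x; have [] := cderE (du x).
have ddu x := cderZ (- s) (du x).
have dduE x : cderive (cderive u) x = s ^+ 2 * u x.
  by rewrite duE; have [_ ->] := cderE (ddu x); rewrite /u; ring.
split.
- move=> x x0; split; first by have [] := cderE (du x).
  by rewrite duE; have [] := cderE (ddu x).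
- by move=> x x0; rewrite dduE hq ?ltW// sE; ring.
- by exists 1 => //; exact: cexp_neq0.
- exists 1 => //; rewrite (_ : (fun x => _) =
      (fun x => (expR (- ((2 * Re s) * x)))%:E)).
    by apply: square_integrable_exp; rewrite mulr_gt0.
  apply/funext => x; congr (_%:E); rewrite normc_cexp !ReImE /= mul0r subr0.
  by rewrite -expRM_natl; congr expR; ring.
Qed.

(** Every Weyl solution satisfies u' = - s u, so the quotient of its boundary limits is - s
    whichever solution is taken; with the explicit exponential as witness this determines the value
    picked by [xget]. *)
Lemma weyl_m_cst (q : R -> R) (q0 : R) z s :
  (forall x, 0 <= x -> q x = q0) -> 0 < Re s -> s ^+ 2 = q0%:C - z ->
  weyl_m q z = - s.
Proof.
move=> hq s0 sE; rewrite /weyl_m; apply: xget_unique.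
- exists (fun x => cexp (x%:C * - s)); split.
    exact: (weyl_solution_exp hq).
  have cexp_cvg : forall e : R, 0 < e ->
      \forall x \near 0^'+, normc (cexp (x%:C * - s) - 1) < e.
    move=> e e0; have [c1 c2] := cder_continuous (cder_cexp (- s) 0).
    have e20 : 0 < e / 2 by rewrite divr_gt0.
    have n1 := cvg_at_right_filter c1.
    have n2 := cvg_at_right_filter c2.
    move/cvgrPdist_lt : n1 => /(_ _ e20) n1.
    move/cvgrPdist_lt : n2 => /(_ _ e20) n2.
    near=> x; apply: le_lt_trans (normc_le_normRe_normIm _) _.
    rewrite [ltRHS](splitr e) !ReImE -cexp0 -(mul0r (- s)).
    by apply: ltrD; rewrite distrC; near: x.
  exists 1, (- s); split.
  + exact/cvg_normcP.
  + have -> : cderive (fun x => cexp (x%:C * - s)) =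
        (fun x => - s * cexp (x%:C * - s)).
      by apply/funext => x; have [] := cderE (cder_cexp (- s) x).
    apply/cvg_normcP => e e0.
    have d0 : 0 < e / (normc s + 1) by rewrite divr_gt0// ltr_wpDl ?normc_ge0.
    move: (cexp_cvg _ d0); apply: filterS => x.
    rewrite ltr_pdivlMr ?ltr_wpDl ?normc_ge0// => hx.
    have -> : - s * cexp (x%:C * - s) - - s = - s * (cexp (x%:C * - s) - 1).
      by ring.
    rewrite normcM normcN mulrC; apply: le_lt_trans hx.
    by rewrite ler_wpM2l ?normc_ge0// lerDl.
  + exact: oner_neq0.
  + by rewrite divr1.
- move=> w [u [wu [u0 [u1 [hu0 hu1 u00 ->]]]]].
  have uE := weyl_solution_decay hq s0 sE wu.
  suff : u1 = - s * u0 by move=> ->; rewrite mulfK.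
  (* If the limits violated the relation by e > 0, points close to 0, where u' = - s u holds
     exactly, would give e < e. *)
  apply/eqP; rewrite -subr_eq0 -normc_eq0; apply/negPn/negP => nz.
  have {nz} : 0 < normc (u1 - - s * u0) by rewrite lt_def nz normc_ge0.
  set e := normc _ => e0.
  have d0 : 0 < e / 2 / (normc s + 1).
    by rewrite !divr_gt0// ltr_wpDl ?normc_ge0.
  have e20 : 0 < e / 2 by rewrite divr_gt0.
  move/cvg_normcP : hu0 => /(_ _ d0) n0.
  move/cvg_normcP : hu1 => /(_ _ e20) n1.
  have : \forall x \near (0 : R)^'+, e < e.
    near=> x.
    have x0 : 0 < x by near: x; exact: nbhs_right_gt.
    have h1 : normc (cderive u x - u1) < e / 2 by near: x.
    have h0 : normc (u x - u0) < e / 2 / (normc s + 1) by near: x.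
    rewrite ltr_pdivlMr ?ltr_wpDl ?normc_ge0// in h0.
    have eE : e = normc (- s * (u x - u0) - (cderive u x - u1)).
      by congr normc; rewrite uE//; ring.
    rewrite [X in X < _]eE.
    apply: le_lt_trans (le_normc_sub _ _) _.
    rewrite [ltRHS](splitr e); apply: ltrD => //.
    rewrite normcM normcN mulrC; apply: le_lt_trans h0.
    by rewrite ler_wpM2l ?normc_ge0// lerDl.
  by move=> /filter_ex[x]; rewrite ltxx.
Unshelve. all: by end_near. Qed.

End WeylSolutions.

(** * Catalan numbers *)

Section Catalan.
Variable R : realType.
Implicit Types (n k K : nat) (x c : R[i]).

Definition catalan k : R := (2 * k)`!%:R / (k`! * k.+1`!)%:R.

Lemma catalan0 : catalan 0 = 1.
Proof. by rewrite /catalan muln0 !fact0 mul1n divr1. Qed.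

Lemma catalanS k :
  (k%:R + 2) * catalan k.+1 = 2 * (2 * k%:R + 1) * catalan k.
Proof.
have k0 : k`!%:R != 0 :> R by rewrite pnatr_eq0 -lt0n fact_gt0.
have k1 : k%:R + 1 != 0 :> R by rewrite natr1 pnatr_eq0.
have k2 : k%:R + 2 != 0 :> R by rewrite -natrD pnatr_eq0 addn2.
rewrite /catalan mulnS add2n !factS !natrM.
rewrite -[(2 * k).+2%:R]natr1 -[(2 * k).+1%:R]natr1 -[k.+2%:R]natr1.
rewrite -[k.+1%:R]natr1 natrM -(addrA k%:R 1 1).
by field; rewrite k0 k1 k2.
Qed.

Lemma catalan_ge0 k : 0 <= catalan k.
Proof. by rewrite /catalan divr_ge0. Qed.

(** The recurrence has ratio 2 (2 k + 1) / (k + 2) <= 4. *)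
Lemma catalan_le k : catalan k <= 4 ^+ k.
Proof.
elim: k => [|k ih]; first by rewrite catalan0 expr0.
rewrite exprS -(ler_pM2l (_ : 0 < k%:R + 2)) ?ltr_wpDl// catalanS.
have k0 : 0 <= k%:R :> R by [].
have c0 : 0 <= 2 * (2 * k%:R + 1) :> R by lra.
apply: le_trans (ler_wpM2l c0 ih) _.
by rewrite mulrA ler_wpM2r ?exprn_ge0//; lra.
Qed.

(* The summand is hypergeometric and Gosper-summable: it is the difference of
   the consecutive values of [t]. *)
Lemma catalan_convolution n :
  \sum_(i < n.+1) catalan i * catalan (n - i) = catalan n.+1.
Proof.
pose t i : R := (i%:R + 1) * (n%:R + 2 - i%:R) * (2 * i%:R - n%:R - 1) /
  (2 * (n%:R + 1) * (n%:R + 2)) * catalan i * catalan (n.+1 - i).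
have n1 : n%:R + 1 != 0 :> R by rewrite natr1 pnatr_eq0.
have n2 : n%:R + 2 != 0 :> R by rewrite -natrD pnatr_eq0 addn2.
have step (i : nat) : (0 <= i < n.+1)%N ->
    catalan i * catalan (n - i) = t i.+1 - t i.
  rewrite ltnS => /andP[_ ni]; pose j := (n - i)%N.
  have nE : n%:R = i%:R + j%:R :> R by rewrite -natrD subnKC.
  have i2 : i%:R + 2 != 0 :> R by rewrite -natrD pnatr_eq0 addn2.
  have j2 : j%:R + 2 != 0 :> R by rewrite -natrD pnatr_eq0 addn2.
  have ci : catalan i.+1 = 2 * (2 * i%:R + 1) * catalan i / (i%:R + 2).
    by rewrite -catalanS mulrAC mulfV// mul1r.
  have cj : catalan j.+1 = 2 * (2 * j%:R + 1) * catalan j / (j%:R + 2).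
    by rewrite -catalanS mulrAC mulfV// mul1r.
  rewrite /t subSS subSn// -/j ci cj -natr1.
  rewrite nE in n1 n2 *.
  by field; rewrite n1 n2 i2 j2.
rewrite -(big_mkord xpredT (fun i => catalan i * catalan (n - i))).
rewrite (eq_big_nat _ _ step) telescope_sumr// /t subnn subn0 catalan0 -natr1.
by field; rewrite n1 n2.
Qed.

(** Truncations of the Catalan generating function, the power series solution of c = 1 + x c^2. *)
Definition catalan_poly K : {poly R[i]} := \poly_(k < K) (catalan k)%:C.

Lemma catalan_polyE K x :
  (catalan_poly K).[x] = \sum_(k < K) (catalan k)%:C * x ^+ k.
Proof. by rewrite horner_poly. Qed.

Lemma catalan_poly_coef K k :
  (catalan_poly K)`_k = if (k < K)%N then (catalan k)%:C else 0.
Proof. by rewrite coef_poly. Qed.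

Lemma normc_catalan_coef K k : normc (catalan_poly K)`_k <= 4 ^+ k.
Proof.
rewrite catalan_poly_coef; case: ifP => _; last by rewrite normc0 exprn_ge0.
by rewrite normcR ger0_norm ?catalan_le// catalan_ge0.
Qed.

(** By the convolution identity both sides agree below degree K + 1. The coefficient of degree n in
    the square is at most (n + 1) 4^n <= 8^n, and 8 |x| <= 1/4, so the K remaining terms contribute
    at most K 4^(-K) <= 2^(-K). *)
Lemma catalan_poly_sqr K x : 32 * normc x <= 1 ->
  normc (1 + x * (catalan_poly K).[x] ^+ 2 - (catalan_poly K.+1).[x])
    <= normc x * 2^-1 ^+ K.
Proof.
move=> x32; set P := catalan_poly K.
have sP : (size (P * P)%R <= K + K)%N.
  apply: leq_trans (size_polyMleq _ _) _; apply: leq_trans (leq_pred _) _.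
  by apply: leq_add; exact: size_poly.
have PP : P.[x] ^+ 2 = \sum_(0 <= n < K + K) (P * P)`_n * x ^+ n.
  by rewrite expr2 -hornerM (horner_coef_wide _ sP) big_mkord.
have low : \sum_(0 <= n < K) (P * P)`_n * x ^+ n =
    \sum_(0 <= n < K) (catalan n.+1)%:C * x ^+ n.
  apply: eq_big_nat => n /andP[_ nK]; congr (_ * _).
  rewrite coefM -catalan_convolution rmorph_sum; apply: eq_bigr => i _.
  rewrite !catalan_poly_coef (leq_ltn_trans (leq_subr _ _) nK).
  by rewrite (leq_ltn_trans _ nK) ?rmorphM// -ltnS.
have -> : 1 + x * P.[x] ^+ 2 - (catalan_poly K.+1).[x] =
    x * \sum_(K <= n < K + K) (P * P)`_n * x ^+ n.
  rewrite catalan_polyE big_ord_recl /= catalan0 expr0 mulr1.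
  rewrite PP (@big_cat_nat _ _ _ K) ?leq_addr//= low big_mkord mulrDr.
  have -> : \sum_(i < K) (catalan (bump 0 i))%:C * x ^+ bump 0 i =
      x * \sum_(i < K) (catalan i.+1)%:C * x ^+ i.
    by rewrite mulr_sumr; apply: eq_bigr => i _; rewrite /bump add1n exprS; ring.
  by rewrite rmorph1; ring.
rewrite normcM ler_wpM2l ?normc_ge0//.
apply: le_trans (normc_sum _ _ _) _.
have term (n : nat) : (K <= n < K + K)%N ->
    normc ((P * P)`_n * x ^+ n) <= 4^-1 ^+ K.
  move=> /andP[Kn _].
  have c1 : normc (P * P)`_n <= 8 ^+ n.
    rewrite coefM; apply: le_trans (normc_sum _ _ _) _.
    apply: (@le_trans _ _ (\sum_(j < n.+1) 4 ^+ n)).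
      apply: ler_sum => j _; rewrite normcM.
      rewrite -[in leRHS](@subnKC j n) -1?ltnS// exprD.
      by rewrite ler_pM ?normc_ge0// normc_catalan_coef.
    have -> : 8 ^+ n = 2 ^+ n * 4 ^+ n :> R.
      by rewrite -exprMn; congr (_ ^+ _); ring.
    rewrite sumr_const card_ord -[_ *+ n.+1]mulr_natl.
    by rewrite ler_wpM2r ?exprn_ge0// -natrX ler_nat ltn_expl.
  rewrite normcM normcX.
  apply: (@le_trans _ _ ((8 * normc x) ^+ n)).
    by rewrite exprMn ler_wpM2r ?exprn_ge0 ?normc_ge0.
  apply: (@le_trans _ _ (4^-1 ^+ n)).
    by rewrite lerXn2r ?nnegrE ?mulr_ge0 ?normc_ge0//; lra.
  by rewrite ler_wiXn2l//; lra.
rewrite big_nat; apply: le_trans (ler_sum _ term) _.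
rewrite -big_nat sumr_const_nat addnK -[_ *+ K]mulr_natl.
have -> : 4^-1 = 2^-1 * 2^-1 :> R by field.
rewrite exprMn mulrA ler_piMl ?exprn_ge0//.
by rewrite exprVn ler_pdivrMr ?exprn_gt0// mul1r -natrX ler_nat ltnW// ltn_expl.
Qed.

Lemma sum_expr_half_le K : \sum_(k < K) 2^-1 ^+ k <= 2 :> R.
Proof.
suff -> : \sum_(k < K) 2^-1 ^+ k = 2 - 2^-1 ^+ K * 2 :> R.
  by rewrite gerBl mulr_ge0 ?exprn_ge0.
elim: K => [|K ih]; first by rewrite big_ord0 expr0 mul1r subrr.
by rewrite big_ord_recr /= ih exprS; field.
Qed.

Lemma normc_catalan_poly K x : 32 * normc x <= 1 ->
  normc (catalan_poly K).[x] <= 2.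
Proof.
move=> x32; rewrite catalan_polyE; apply: le_trans (normc_sum _ _ _) _.
apply: le_trans (sum_expr_half_le K); apply: ler_sum => k _.
rewrite normcM normcR ger0_norm ?catalan_ge0// normcX.
apply: (@le_trans _ _ ((4 * normc x) ^+ k)).
  by rewrite exprMn ler_wpM2r ?exprn_ge0 ?normc_ge0// catalan_le.
by rewrite lerXn2r ?nnegrE ?mulr_ge0 ?normc_ge0//; lra.
Qed.

(* The Catalan polynomials are, up to a small error, the iterates of
   [c |-> 1 + x * c ^+ 2], a contraction for small [x]. *)
Lemma catalan_poly_cvg x c (C : R) K : c = 1 + x * c ^+ 2 -> normc c <= C ->
  32 * normc x <= 1 -> 4 * (normc x * (C + 2)) <= 1 ->
  normc (c - (catalan_poly K).[x]) <= (C + 1) * 2^-1 ^+ K.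
Proof.
move=> cE cC x32 xC.
have C0 : 0 <= C := le_trans (normc_ge0 c) cC.
elim: K => [|K ih].
  by rewrite catalan_polyE big_ord0 subr0 expr0 mulr1; lra.
set p := (catalan_poly K).[x]; set p' := (catalan_poly K.+1).[x].
have -> : c - p' = x * (c + p) * (c - p) + (1 + x * p ^+ 2 - p').
  by rewrite [in LHS]cE; ring.
apply: le_trans (le_normcD _ _) _; rewrite !normcM.
have e1 := catalan_poly_sqr K x32; rewrite -/p -/p' in e1.
(* The contraction factor is 1/4; with the extra 1/32 coming from [e1] it stays below the 1/2
   allowed per step. *)
have e2 : normc x * normc (c + p) <= 4^-1.
  apply: (@le_trans _ _ (normc x * (C + 2))); last by lra.
  rewrite ler_wpM2l ?normc_ge0//; apply: le_trans (le_normcD _ _) _.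
  by apply: lerD => //; exact: normc_catalan_poly.
have h0 : 0 <= 2^-1 ^+ K :> R by rewrite exprn_ge0.
have := ler_pM (mulr_ge0 (normc_ge0 _) (normc_ge0 _)) (normc_ge0 _) e2 ih => h1.
have h2 : normc x * 2^-1 ^+ K <= 2^-1 ^+ K / 32.
  by rewrite mulrC ler_wpM2l//; lra.
have h3 : 0 <= C * 2^-1 ^+ K by rewrite mulr_ge0.
apply: le_trans (lerD h1 (le_trans e1 h2)) _.
by rewrite exprS; lra.
Qed.

(** A root with zero real part would have a real square; otherwise one of the two opposite roots
    lies in the right half-plane. *)
Lemma sqrt_pos_Re (z : R[i]) : Im z != 0 ->
  exists2 s : R[i], s ^+ 2 = z & 0 < Re s.
Proof.
move=> Imz; pose s := sqrtc z.
have sE : s ^+ 2 = z := sqr_sqrtc z.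
have : Re s != 0.
  apply: contra Imz => /eqP Res; rewrite -sE expr2 !ReImE.
  by rewrite Res mul0r mulr0 addr0.
rewrite neq_lt => /orP[s0|s0]; last by exists s.
by exists (- s); rewrite ?sqrrN// ReImE oppr_gt0.
Qed.

End Catalan.

(** * Weighted integrals of complex-valued functions *)

Section ComplexIntegrals.
Variable R : realType.
Implicit Types (a x t : R) (b phi : R -> R) (g h u : R -> R[i]).
Local Notation mu := (@lebesgue_measure R).

Definition ccontinuous g :=
  continuous (fun t => Re (g t)) /\ continuous (fun t => Im (g t)).

Lemma cder_ccontinuous u (v : R -> R[i]) :
  (forall t, cder u t (v t)) -> ccontinuous u.
Proof. by move=> du; split => t; have [] := cder_continuous (du t). Qed.

Lemma ccontinuous_cexp (z : R[i]) : ccontinuous (fun t => cexp (t%:C * z)).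
Proof. by apply: cder_ccontinuous => t; exact: cder_cexp. Qed.

Lemma ccontinuousR phi : continuous phi -> ccontinuous (fun t => (phi t)%:C).
Proof. by move=> cphi; split => //= t; exact: cvg_cst. Qed.

Lemma ccontinuousD g h :
  ccontinuous g -> ccontinuous h -> ccontinuous (fun t => g t + h t).
Proof.
move=> [g1 g2] [h1 h2]; split => t.
- rewrite (_ : (fun t => Re _) = fun t => Re (g t) + Re (h t)).
    by apply: cvgD; [exact: g1|exact: h1].
  by apply/funext => x; rewrite ReImE.
- rewrite (_ : (fun t => Im _) = fun t => Im (g t) + Im (h t)).
    by apply: cvgD; [exact: g2|exact: h2].
  by apply/funext => x; rewrite ReImE.
Qed.

Lemma ccontinuousM g h :
  ccontinuous g -> ccontinuous h -> ccontinuous (fun t => g t * h t).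
Proof.
move=> [g1 g2] [h1 h2]; split => t.
- rewrite (_ : (fun t => Re _) = fun t => Re (g t) * Re (h t) - Im (g t) * Im (h t)).
    by apply: cvgB; apply: cvgM; [exact: g1|exact: h1|exact: g2|exact: h2].
  by apply/funext => x; rewrite ReImE.
- rewrite (_ : (fun t => Im _) = fun t => Re (g t) * Im (h t) + Im (g t) * Re (h t)).
    by apply: cvgD; apply: cvgM; [exact: g1|exact: h2|exact: g2|exact: h1].
  by apply/funext => x; rewrite ReImE.
Qed.

Lemma ccontinuous_cst (z : R[i]) : ccontinuous (fun=> z).
Proof. by split => t; exact: cvg_cst. Qed.

Lemma ccontinuousZ (z : R[i]) g : ccontinuous g -> ccontinuous (fun t => z * g t).
Proof. exact/ccontinuousM/ccontinuous_cst. Qed.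

Lemma ccontinuous_sum n (F : 'I_n -> R -> R[i]) :
  (forall i, ccontinuous (F i)) -> ccontinuous (fun t => \sum_(i < n) F i t).
Proof.
elim: n F => [|n ih] F cF.
  by under eq_fun do rewrite big_ord0; exact: ccontinuous_cst.
under eq_fun do rewrite big_ord_recr /=.
by apply: ccontinuousD => //; apply: ih => i; exact: cF.
Qed.

Lemma continuous_segment_bounded a phi : continuous phi -> 0 <= a ->
  exists M : R, forall t, t \in `[0, a] -> `|phi t| <= M.
Proof.
move=> cphi a0.
have cn : {within `[0, a], continuous (fun t => `|phi t|)}.
  by apply: continuous_subspaceT => t; apply: cvg_norm; exact: cphi.
have [c _ hc] := EVT_max a0 cn.
by exists `|phi c| => t; exact: hc.
Qed.

Lemma integrableM_continuous a b phi : 0 <= a ->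
  mu.-integrable `]0, a[ (EFin \o b) -> continuous phi ->
  mu.-integrable `]0, a[ (EFin \o (fun t => b t * phi t)).
Proof.
move=> a0 ib cphi; have [M hM] := continuous_segment_bounded cphi a0.
have -> : EFin \o (fun t => b t * phi t) = ((EFin \o b) \* (EFin \o phi))%E.
  by apply/funext.
apply: integrableMl => //.
  apply: (@measurable_funS _ _ _ _ setT) => //.
  exact: continuous_measurable_fun.
exists M; split; first exact: num_real.
move=> x Mx t /= t0a; apply: le_trans (ltW Mx); apply: hM.
by move: t0a; apply: subset_itv_oo_cc.
Qed.

(** Regarded as a linear functional of [g] for a fixed weight: [b] is merely integrable and [g]
    continuous, which keeps every product integrable on the bounded interval. *)
Definition wintegral a b g : R[i] := cintegral 0 a (fun t => (b t)%:C * g t).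

Lemma wintegralE a b g : wintegral a b g =
  (\int[mu]_(t in `]0, a[) (b t * Re (g t))) +i*
  (\int[mu]_(t in `]0, a[) (b t * Im (g t))).
Proof.
by rewrite /wintegral /cintegral; congr (_ +i* _); apply: eq_Rintegral => t _;
  rewrite ReImE /= ?mul0r ?subr0 ?addr0.
Qed.

Section Weight.
Variables (a : R) (b : R -> R).
Hypotheses (a0 : 0 <= a) (ib : mu.-integrable `]0, a[ (EFin \o b)).
Local Notation T := (wintegral a b).

Lemma eq_wintegral g h : {in `]0, a[, g =1 h} -> T g = T h.
Proof.
move=> gh; rewrite !wintegralE; congr (_ +i* _); apply: eq_Rintegral => t;
  by rewrite inE => t0; rewrite gh.
Qed.

Lemma wintegralD g h : ccontinuous g -> ccontinuous h ->
  T (fun t => g t + h t) = T g + T h.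
Proof.
move=> [g1 g2] [h1 h2]; rewrite !wintegralE; apply: complex_ext => /=.
- rewrite -RintegralD//; [|exact: integrableM_continuous..].
  by apply: eq_Rintegral => t _; rewrite ReImE mulrDr.
- rewrite -RintegralD//; [|exact: integrableM_continuous..].
  by apply: eq_Rintegral => t _; rewrite ReImE mulrDr.
Qed.

Lemma wintegralZ (z : R[i]) g : ccontinuous g -> T (fun t => z * g t) = z * T g.
Proof.
move=> [g1 g2]; rewrite !wintegralE.
have i1 := integrableM_continuous a0 ib g1.
have i2 := integrableM_continuous a0 ib g2.
have iZ r (f : R -> R) : mu.-integrable `]0, a[ (EFin \o f) ->
    mu.-integrable `]0, a[ (EFin \o (fun t => r * f t)).
  by move=> intf; have := integrableZl _ r intf; exact.
apply: complex_ext; rewrite !ReImE /=.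
- rewrite -!RintegralZl// -RintegralB//; [|exact: iZ..].
  by apply: eq_Rintegral => t _; rewrite ReImE; ring.
- rewrite -!RintegralZl// -RintegralD//; [|exact: iZ..].
  by apply: eq_Rintegral => t _; rewrite ReImE; ring.
Qed.

Lemma wintegral_sum n (F : 'I_n -> R -> R[i]) : (forall i, ccontinuous (F i)) ->
  T (fun t => \sum_(i < n) F i t) = \sum_(i < n) T (F i).
Proof.
elim: n F => [|n ih] F cF.
  under eq_fun do rewrite big_ord0.
  rewrite big_ord0 -[RHS](mul0r (T (fun=> 0))) -wintegralZ.
    by apply: eq_wintegral => t _; rewrite mul0r.
  exact: ccontinuous_cst.
under eq_fun do rewrite big_ord_recr /=.
rewrite wintegralD ?big_ord_recr ?ih//; apply: ccontinuous_sum => i; exact: cF.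
Qed.

(** The factor 2 comes from bounding real and imaginary parts separately; only exponential rates
    matter later. *)
Lemma normc_wintegral_le (M : R) g : ccontinuous g -> 0 <= M ->
  {in `]0, a[, forall t, normc (g t) <= M} ->
  normc (T g) <= 2 * (\int[mu]_(t in `]0, a[) `|b t|) * M.
Proof.
move=> [g1 g2] M0 gM; rewrite wintegralE.
apply: le_trans (normc_le_normRe_normIm _) _ => /=.
have inb : mu.-integrable `]0, a[ (EFin \o (fun t => `|b t|)).
  exact: integrable_norm.
have bound phi : continuous phi -> {in `]0, a[, forall t, `|phi t| <= M} ->
    `|\int[mu]_(t in `]0, a[) (b t * phi t)| <= (\int[mu]_(t in `]0, a[) `|b t|) * M.
  move=> cphi pM; have ibp := integrableM_continuous a0 ib cphi.
  apply: le_trans (le_normr_Rintegral _ ibp) _ => //.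
  rewrite -RintegralZr//; apply: le_Rintegral => //.
  - exact: integrable_norm.
  - exact: (integrableM_continuous a0 inb (@cst_continuous _ _ M)).
  - by move=> t t0; rewrite normrM ler_wpM2l// pM.
rewrite -mulrA mulr_natl mulr2n.
by apply: lerD; apply: bound => // t /gM; apply: le_trans;
  [exact: normRe_le_normc|exact: normIm_le_normc].
Qed.

Lemma wintegral_conj g : ccontinuous g -> T (fun t => (g t)^*) = (T g)^*.
Proof.
move=> [g1 g2]; rewrite !wintegralE /=; congr (_ +i* _).
- by apply: eq_Rintegral => t _; case: (g t).
- have i2 := integrableM_continuous a0 ib g2.
  rewrite -[in RHS]mulN1r -RintegralZl//.
  by apply: eq_Rintegral => t _; case: (g t) => r1 r2 /=; rewrite mulrN mulN1r.
Qed.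

End Weight.

Lemma wintegralBl a b1 b2 g : 0 <= a ->
  mu.-integrable `]0, a[ (EFin \o b1) -> mu.-integrable `]0, a[ (EFin \o b2) ->
  ccontinuous g ->
  wintegral a (fun t => b1 t - b2 t) g = wintegral a b1 g - wintegral a b2 g.
Proof.
move=> a0 i1 i2 [g1 g2]; rewrite !wintegralE; apply: complex_ext => /=.
- rewrite -RintegralB//; [|exact: integrableM_continuous..].
  by apply: eq_Rintegral => t _; rewrite mulrBl.
- rewrite -RintegralB//; [|exact: integrableM_continuous..].
  by apply: eq_Rintegral => t _; rewrite mulrBl.
Qed.

Lemma continuous_integrable_oo a phi : continuous phi ->
  mu.-integrable `]0, a[ (EFin \o phi).
Proof.
move=> cphi; apply: (@integrableS _ _ _ mu `[0, a]) => //.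
  exact: subset_itv_oo_cc.
apply: continuous_compact_integrable; first exact: segment_compact.
exact: continuous_subspaceT.
Qed.

Lemma cintegral_cder a u v : 0 < a -> (forall t, cder u t (v t)) ->
  ccontinuous v -> cintegral 0 a v = u a - u 0.
Proof.
move=> a0 du [v1 v2].
have ftc (f F : R -> R) : continuous f -> (forall t, is_derive t 1 F (f t)) ->
    \int[mu]_(t in `]0, a[) f t = F a - F 0.
  move=> cf dF.
  have cF t : {for t, continuous F}.
    apply/differentiable_continuous/derivable1_diffP.
    by have := dF t => ?; exact: ex_derive.
  have mf : measurable_fun `]0, a[ (EFin \o f).
    by have /integrableP[] := @continuous_integrable_oo a f cf.
  rewrite /Rintegral -(@integral_itv_bndoo _ _ _ _ true false)//.
  rewrite (@continuous_FTC2 _ f F 0 a)//.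
  - exact: continuous_subspaceT.
  - split.
    + by move=> t _; have := dF t => ?; exact: ex_derive.
    + exact/cvg_at_right_filter/cF.
    + exact/cvg_at_left_filter/cF.
  - by move=> t _; have := dF t => ?; rewrite derive1E derive_val.
rewrite /cintegral; apply: complex_ext; rewrite !ReImE /=.
- by apply: (ftc _ (fun t => Re (u t)) v1) => t; have [] := du t.
- by apply: (ftc _ (fun t => Im (u t)) v2) => t; have [] := du t.
Qed.

End ComplexIntegrals.

(** * The Laplace transform of the amplitude *)

Section ExponentialSeries.
Variable R : realType.
Implicit Types (c : nat -> R) (C r x : R).

(** This class of coefficients is stable under formal differentiation, up to the constant, and the
    sums are bounded by C exp(r |x|). *)
Definition exp_dominated c C r := forall k, `|c k| <= C * (r ^+ k / k`!%:R).

Lemma exp_dominatedX c C r x : exp_dominated c C r ->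
  forall k, `|c k * x ^+ k| <= C * exp_coeff (r * `|x|) k.
Proof.
move=> cC k; rewrite normrM normrX /exp_coeff /= exprMn mulrAC mulrA.
by rewrite ler_wpM2r ?exprn_ge0.
Qed.

Lemma series_exp_coeff_le x n : 0 <= x -> series (exp_coeff x) n <= expR x.
Proof.
move=> x0; apply: nondecreasing_cvgn_le; last exact: is_cvg_series_exp_coeff.
by apply: nondecreasing_series => i _ _; exact: exp_coeff_ge0.
Qed.

Lemma exp_dominated_pseries_le c C r x K : 0 <= C -> 0 <= r ->
  exp_dominated c C r -> `|pseries c x K| <= C * expR (r * `|x|).
Proof.
move=> C0 r0 cC; rewrite /pseries /series /=.
apply: le_trans (ler_norm_sum _ _ _) _.
apply: le_trans (ler_sum _ (fun k _ => exp_dominatedX x cC k)) _.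
rewrite -mulr_sumr ler_wpM2l//; apply: series_exp_coeff_le.
by rewrite mulr_ge0.
Qed.

Lemma exp_dominated_cvg c C r x : 0 <= C -> 0 <= r -> exp_dominated c C r ->
  cvgn (pseries c x).
Proof.
move=> C0 r0 cC; apply: normed_cvg.
apply: (@series_le_cvg _ _ (fun k => C * exp_coeff (r * `|x|) k)).
- by move=> k /=.
- by move=> k; rewrite mulr_ge0// exp_coeff_ge0// mulr_ge0.
- by move=> k; exact: exp_dominatedX.
- by apply: is_cvg_seriesZ; exact: is_cvg_series_exp_coeff.
Qed.

Lemma exp_dominated_diffs c C r : exp_dominated c C r ->
  exp_dominated (pseries_diffs c) (C * r) r.
Proof.
move=> cC k; rewrite /pseries_diffs normrM ger0_norm//.
apply: le_trans (ler_wpM2l _ (cC k.+1)) _ => //.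
rewrite factS natrM exprS le_eqVlt; apply/orP; left; apply/eqP.
have k0 : k`!%:R != 0 :> R by rewrite pnatr_eq0 -lt0n fact_gt0.
have k1 : k%:R + 1 != 0 :> R by rewrite natr1 pnatr_eq0.
by rewrite -natr1; field; rewrite k0 k1.
Qed.

(** The sum is even differentiable: termwise differentiation asks for convergence of the series and
    of its first two formal derivatives at a point beyond |x|, all in the same class. *)
Lemma exp_dominated_continuous c C r : 0 <= C -> 0 <= r ->
  exp_dominated c C r -> continuous (fun x => limn (pseries c x)).
Proof.
move=> C0 r0 cC x; apply/differentiable_continuous/derivable1_diffP.
have dC := exp_dominated_diffs cC; have ddC := exp_dominated_diffs dC.
have Cr0 : 0 <= C * r by rewrite mulr_ge0.
have Crr0 : 0 <= C * r * r by rewrite mulr_ge0.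
have xK : `|x| < `| `|x| + 1 |.
  by rewrite [ltRHS]ger0_norm ?addr_ge0// ltrDl.
have := @pseries_snd_diffs R c (`|x| + 1) x
  (@exp_dominated_cvg c C r _ C0 r0 cC)
  (@exp_dominated_cvg _ _ _ _ Cr0 r0 dC)
  (@exp_dominated_cvg _ _ _ _ Crr0 r0 ddC) xK => ?.
exact: ex_derive.
Qed.

End ExponentialSeries.

(** * The candidate amplitude and its truncated Laplace integral *)

Section LaplaceTransform.
Variable R : realType.
Implicit Types (q a t rho : R) (z k s : R[i]).
Local Notation mu := (@lebesgue_measure R).

Definition amp_coef q0 (k : nat) : R :=
  (-1) ^+ k * q0 ^+ k.+1 / (k`! * k.+1`!)%:R.

Definition amp_poly q0 K t : R := pseries (amp_coef q0) (t ^+ 2) K.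

(** As a power series in t^2 it is also meaningful at t = 0, where the Bessel quotients divide by
    zero. *)
Definition amp q0 t : R := limn (pseries (amp_coef q0) (t ^+ 2)).

Lemma amp_coef_dominated q0 : exp_dominated (amp_coef q0) `|q0| `|q0|.
Proof.
move=> k; rewrite /amp_coef normrM normrM normrX normrN1 expr1n mul1r normrX.
rewrite exprS -mulrA ler_wpM2l// ler_wpM2l ?exprn_ge0// normfV ger0_norm//.
rewrite lef_pV2 ?posrE ?ltr0n ?muln_gt0 ?fact_gt0// ler_nat.
by rewrite leq_pmulr// fact_gt0.
Qed.

Lemma amp_poly_cvg q0 t : amp_poly q0 ^~ t @ \oo --> amp q0 t.
Proof.
exact: (@exp_dominated_cvg R _ _ _ _ (normr_ge0 q0) (normr_ge0 q0)
  (amp_coef_dominated q0)).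
Qed.

Lemma amp_continuous q0 : continuous (amp q0).
Proof.
move=> t; apply: (@continuous_comp _ _ _ (fun t => t ^+ 2)
  (fun x => limn (pseries (amp_coef q0) x))).
  exact: exprn_continuous.
exact: (@exp_dominated_continuous R _ _ _ (normr_ge0 q0) (normr_ge0 q0)
  (amp_coef_dominated q0)).
Qed.

Lemma amp_polyE q0 K t : amp_poly q0 K t = \sum_(k < K) amp_coef q0 k * t ^+ (2 * k).
Proof.
rewrite /amp_poly /pseries /series /= big_mkord; apply: eq_bigr => k _.
by rewrite exprM.
Qed.

Lemma amp_poly_continuous q0 K : continuous (amp_poly q0 K).
Proof.
elim: K => [|K ih] t.
  rewrite (_ : amp_poly q0 0 = cst 0); first exact: cst_continuous.
  by apply/funext => x; rewrite amp_polyE big_ord0.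
rewrite (_ : amp_poly q0 K.+1 =
    fun x => amp_poly q0 K x + amp_coef q0 K * x ^+ (2 * K)).
  apply: cvgD; first exact: ih.
  by apply: cvgM; [exact: cvg_cst|exact: exprn_continuous].
by apply/funext => x; rewrite !amp_polyE big_ord_recr.
Qed.

(** Dominated convergence: on a bounded interval one constant dominates all partial sums. This is
    what justifies integrating term by term. *)
Lemma amp_poly_integral_cvg q0 a (phi : R -> R) : 0 <= a -> continuous phi ->
  (\int[mu]_(t in `]0, a[) (amp_poly q0 K t * phi t)) @[K --> \oo] -->
  \int[mu]_(t in `]0, a[) (amp q0 t * phi t).
Proof.
move=> a0 cphi; have [M hM] := continuous_segment_bounded cphi a0.
have M0 : 0 <= M by apply: le_trans (hM 0 _) => //; rewrite in_itv/= lexx.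
have ip (b : R -> R) : continuous b -> mu.-integrable `]0, a[ (EFin \o (fun t => b t * phi t)).
  by move=> cb; apply: integrableM_continuous => //; exact: continuous_integrable_oo.
apply: fine_cvg; rewrite fineK; last first.
  by apply: integrable_fin_num => //; exact/ip/amp_continuous.
apply: (@dominated_cvg _ _ _ mu _ _ _ _
  (cst (`|q0| * expR (`|q0| * a ^+ 2) * M)%:E)) => //.
- by move=> K; have /integrableP[] := ip _ (@amp_poly_continuous q0 K).
- move=> t _; apply: cvg_EFin; first by near=> K.
  by apply: cvgM; [exact: amp_poly_cvg|exact: cvg_cst].
- exact: (@continuous_integrable_oo _ _ (cst _) (@cst_continuous _ _ _)).
- move=> K t /=; rewrite in_itv/= => /andP[t0 ta].
  rewrite lee_fin normrM ler_pM//; last by apply: hM; rewrite in_itv/= !ltW.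
  apply: le_trans (exp_dominated_pseries_le _ _ _ _ (amp_coef_dominated q0)) _ => //.
  rewrite ler_wpM2l// ler_expR ler_wpM2l// ger0_norm ?sqr_ge0//.
  by apply: lerXn2r; [exact: ltW|exact: a0|exact: ltW].
Unshelve. all: by end_near. Qed.

Lemma amp_poly_wintegral_cvg q0 a (g : R -> R[i]) (e : R) : 0 <= a -> 0 < e ->
  ccontinuous g ->
  \forall K \near \oo, normc (wintegral a (amp_poly q0 K) g - wintegral a (amp q0) g) < e.
Proof.
move=> a0 e0 [g1 g2]; have e20 : 0 < e / 2 by rewrite divr_gt0.
have /cvgrPdist_lt/(_ _ e20) n1 := @amp_poly_integral_cvg q0 _ _ a0 g1.
have /cvgrPdist_lt/(_ _ e20) n2 := @amp_poly_integral_cvg q0 _ _ a0 g2.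
near=> K; apply: le_lt_trans (normc_le_normRe_normIm _) _.
rewrite [ltRHS](splitr e) !wintegralE !ReImE /=.
by apply: ltrD; rewrite distrC; near: K.
Unshelve. all: by end_near. Qed.

Definition laplace_monomial a z j : R[i] :=
  wintegral a (fun=> 1) (fun t => (t ^+ j)%:C * cexp (t%:C * - z)).

Lemma ccontinuous_monomial_cexp z j :
  ccontinuous (fun t => (t ^+ j)%:C * cexp (t%:C * z)).
Proof.
apply: ccontinuousM; last exact: ccontinuous_cexp.
by apply: ccontinuousR; exact: exprn_continuous.
Qed.

Lemma integrable1 a : mu.-integrable `]0, a[ (EFin \o (fun=> 1)).
Proof. exact: (@continuous_integrable_oo _ _ (cst 1) (@cst_continuous _ _ _)). Qed.

Lemma wintegral1 a g : wintegral a (fun=> 1) g = cintegral 0 a g.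
Proof.
by rewrite wintegralE; congr (_ +i* _); apply: eq_Rintegral => t _;
  rewrite mul1r.
Qed.

Lemma laplace_monomial0 a z : 0 < a ->
  z * laplace_monomial a z 0 = 1 - cexp (a%:C * - z).
Proof.
move=> a0; have cE := @ccontinuous_monomial_cexp (- z) 0.
have := @cintegral_cder _ _ _ _ a0 (cder_cexp (- z))
  (ccontinuousZ (- z) (ccontinuous_cexp (- z))).
rewrite -wintegral1 wintegralZ ?ltW//; [|exact: integrable1|exact: ccontinuous_cexp].
rewrite (mul0r (- z)) cexp0 => h; rewrite -[RHS]opprB -h mulNr opprK; congr (_ * _).
by apply: eq_wintegral => t _; rewrite expr0 mul1r.
Qed.

Lemma laplace_monomialS a z j : 0 < a ->
  z * laplace_monomial a z j.+1 =
  j.+1%:R * laplace_monomial a z j - (a ^+ j.+1)%:C * cexp (a%:C * - z).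
Proof.
move=> a0; have cE := @ccontinuous_monomial_cexp (- z).
have d t : cder (fun t => (t ^+ j.+1)%:C * cexp (t%:C * - z)) t
    (j.+1%:R * ((t ^+ j)%:C * cexp (t%:C * - z)) +
     - z * ((t ^+ j.+1)%:C * cexp (t%:C * - z))).
  apply: cder_eq (cderM (cderR (is_derive_expn j t)) (cder_cexp (- z) t)).
  by rewrite rmorphM rmorph_nat; ring.
have := cintegral_cder a0 d _.
rewrite -wintegral1 wintegralD ?ltW//; last 3 first.
- exact: integrable1.
- exact: ccontinuousZ.
- exact: ccontinuousZ.
rewrite !wintegralZ ?ltW//; [|exact: integrable1..].
move=> h; rewrite -/(laplace_monomial a z j) -/(laplace_monomial a z j.+1) in h.
rewrite -[X in _ - X]subr0 -[X in _ - (_ - X)](mul0r (cexp (0%:C * - z))).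
rewrite (_ : 0 * cexp _ = (0 ^+ j.+1)%:C * cexp (0%:C * - z)); last first.
  by rewrite expr0n.
rewrite -h; first by ring.
by apply: ccontinuousD; exact: ccontinuousZ.
Qed.

(* The integral over [0, a] differs from the one over the half-line,
   [j`! / z ^+ j.+1], by a multiple of the exponential at the cut-off. *)
Lemma laplace_monomial_tail a z rho j : 0 < a -> 0 < rho -> rho <= normc z ->
  normc (laplace_monomial a z j - j`!%:R / z ^+ j.+1) <=
  normc (cexp (a%:C * - z)) * expR (a * rho) * (j`!%:R / rho ^+ j.+1).
Proof.
move=> a0 r0 rz; set E := normc (cexp _).
have z_gt0 := lt_le_trans r0 rz.
have z0 : z != 0 by rewrite -normc_gt0.
have E0 : 0 <= E by exact: normc_ge0.
have ar0 : 0 <= a * rho by rewrite mulr_ge0 ?ltW.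
(* The exact tail is j! / z^(j+1) exp(- a z) times the sum of (a z)^i / i! for i <= j. Only negative
   powers of |z| remain after expansion, so [rho] may replace |z|; the induction adds one term of
   this sum at each step. *)
pose S n : R := \sum_(i < n) (a * rho) ^+ i / i`!%:R.
have Sle n : S n <= expR (a * rho).
  by have := series_exp_coeff_le n ar0; rewrite /series /= big_mkord.
suff h : normc (laplace_monomial a z j - j`!%:R / z ^+ j.+1) <=
    E * S j.+1 * (j`!%:R / rho ^+ j.+1).
  apply: le_trans h _; rewrite ler_wpM2r ?divr_ge0 ?exprn_ge0 ?(ltW r0)//.
  by rewrite ler_wpM2l.
have r_neq0 : rho != 0 by rewrite gt_eqF.
have divz (x : R[i]) (y : R) : normc (z * x) <= y -> normc x <= y / rho.
  rewrite normcM => h; rewrite ler_pdivlMr// mulrC; apply: le_trans h.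
  by rewrite ler_wpM2r ?normc_ge0.
elim: j => [|j ih].
  rewrite /S big_ord_recl big_ord0 /= expr0 fact0 !divr1 addr0 mulr1 expr1 mul1r.
  rewrite expr1 div1r.
  apply: divz; rewrite mulrBr laplace_monomial0// mulfV//.
  by rewrite (_ : 1 - _ - 1 = - cexp (a%:C * - z)) ?normcN//; ring.
have -> : E * S j.+2 * (j.+1`!%:R / rho ^+ j.+2) =
    (j.+1%:R * (E * S j.+1 * (j`!%:R / rho ^+ j.+1)) + a ^+ j.+1 * E) / rho.
  have f0 : j.+1`!%:R != 0 :> R by rewrite pnatr_eq0 -lt0n fact_gt0.
  rewrite [S j.+2]big_ord_recr /= -/(S _) exprMn.
  rewrite (_ : j.+1%:R * _ = E * S j.+1 * (j.+1`!%:R / rho ^+ j.+1)); last first.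
    by rewrite factS natrM; ring.
  rewrite [rho ^+ j.+2]exprS.
  by field; rewrite f0 r_neq0 /= expf_neq0.
apply: divz.
have -> : z * (laplace_monomial a z j.+1 - j.+1`!%:R / z ^+ j.+2) =
    j.+1%:R * (laplace_monomial a z j - j`!%:R / z ^+ j.+1) -
    (a ^+ j.+1)%:C * cexp (a%:C * - z).
  rewrite mulrBr laplace_monomialS// factS natrM [z ^+ j.+2]exprS.
  by field; rewrite z0 expf_neq0.
apply: le_trans (le_normc_sub _ _) _; rewrite !normcM normc_natr normcR.
rewrite (ger0_norm (exprn_ge0 _ (ltW a0))); apply: lerD => //.
by rewrite ler_wpM2l.
Qed.

Lemma wintegral_amp_poly q0 a z K : 0 < a ->
  wintegral a (amp_poly q0 K) (fun t => cexp (t%:C * - z)) =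
  \sum_(k < K) (amp_coef q0 k)%:C * laplace_monomial a z (2 * k).
Proof.
move=> a0.
have -> : wintegral a (amp_poly q0 K) (fun t => cexp (t%:C * - z)) =
    wintegral a (fun=> 1) (fun t => \sum_(k < K) (amp_coef q0 k)%:C *
      ((t ^+ (2 * k))%:C * cexp (t%:C * - z))).
  rewrite wintegral1; congr cintegral; apply/funext => t.
  rewrite amp_polyE rmorph_sum mulr_suml; apply: eq_bigr => k _.
  by rewrite rmorphM mulrA.
rewrite wintegral_sum ?ltW//; [|exact: integrable1|].
  apply: eq_bigr => k _; rewrite wintegralZ ?ltW//; first exact: integrable1.
  exact: ccontinuous_monomial_cexp.
by move=> k; apply: ccontinuousZ; exact: ccontinuous_monomial_cexp.
Qed.

(** The factorial (2 k)! produced by the Laplace transform of t^(2 k) is what turns the coefficients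
    into Catalan numbers. *)
Lemma amp_coef_fact q0 (k : nat) :
  amp_coef q0 k * (2 * k)`!%:R = (-1) ^+ k * q0 ^+ k.+1 * catalan R k.
Proof. by rewrite /amp_coef /catalan; ring. Qed.

(** The threshold [rho] satisfies rho >= 1 and rho^2 >= 8 |q0|, so the cut-off errors of the terms
    are at most |q0| (4 |q0| / rho^2)^k times the exponentials, a geometric series of ratio at most
    1/2. The bound is uniform in [K]. *)
Lemma wintegral_amp_poly_tail q0 a z K : 0 < a -> 8 * `|q0| + 1 <= normc z ->
  normc (q0%:C / z * (catalan_poly R K).[- q0%:C / z ^+ 2] -
    wintegral a (amp_poly q0 K) (fun t => cexp (t%:C * - z))) <=
  2 * `|q0| * expR (a * (8 * `|q0| + 1)) * expR (- (a * Re z)).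
Proof.
move=> a0; set rho := 8 * `|q0| + 1 => rz.
have q00 : 0 <= `|q0| by [].
have r1 : 1 <= rho by rewrite /rho lerDr mulr_ge0.
have r0 : 0 < rho by exact: lt_le_trans r1.
have z_gt0 := lt_le_trans r0 rz.
have z0 : z != 0 by rewrite -normc_gt0.
set E := expR (- (a * Re z)).
have EE : normc (cexp (a%:C * - z)) = E.
  by rewrite normc_cexp !ReImE /= mul0r subr0 mulrN.
have -> : q0%:C / z * (catalan_poly R K).[- q0%:C / z ^+ 2] =
    \sum_(k < K) (amp_coef q0 k)%:C * ((2 * k)`!%:R / z ^+ (2 * k).+1).
  rewrite catalan_polyE mulr_sumr; apply: eq_bigr => k _.
  have cE : (amp_coef q0 k)%:C * (2 * k)`!%:R =
      ((-1) ^+ k * q0 ^+ k.+1 * catalan R k)%:C.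
    by rewrite -amp_coef_fact -(rmorph_nat (real_complex R)) -rmorphM.
  have cE' : ((-1) ^+ k * q0 ^+ k.+1 * catalan R k)%:C =
      (-1) ^+ k * q0%:C ^+ k.+1 * (catalan R k)%:C.
    by move: (catalan R k) => c; rewrite !rmorphM !rmorphXn rmorphN rmorph1.
  rewrite [RHS]mulrA cE cE' -[- q0%:C]mulN1r expr_div_n exprMn.
  rewrite [z ^+ (2 * k).+1]exprS exprM [q0%:C ^+ k.+1]exprS.
  by field; rewrite z0 !expf_neq0.
rewrite wintegral_amp_poly// -sumrB; apply: le_trans (normc_sum _ _ _) _.
apply: (@le_trans _ _
    (\sum_(k < K) (E * expR (a * rho) * `|q0|) * 2^-1 ^+ k)).
  apply: ler_sum => k _; rewrite -mulrBr normcM normc_distC normcR.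
  apply: le_trans (ler_wpM2l _ (laplace_monomial_tail _ a0 r0 rz)) _ => //.
  rewrite EE mulrCA -[leRHS]mulrA ler_wpM2l ?mulr_ge0 ?expR_ge0//.
  have c1 : `|amp_coef q0 k| * (2 * k)`!%:R <= `|q0| * (4 * `|q0|) ^+ k.
    rewrite -[X in _ * X](ger0_norm (ler0n R _)) -normrM amp_coef_fact.
    rewrite normrM (ger0_norm (catalan_ge0 _ _)) normrM !normrX normrN1 expr1n mul1r.
    rewrite exprS exprMn -mulrA ler_wpM2l// mulrC ler_wpM2r ?exprn_ge0//.
    exact: catalan_le.
  have c2 : (rho ^+ (2 * k).+1)^-1 <= (rho ^+ 2)^-1 ^+ k.
    rewrite exprVn -exprM exprS invfM ler_piMl ?invf_le1//.
    by rewrite invr_ge0 exprn_ge0// ltW.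
  rewrite mulrA; apply: le_trans (ler_pM _ _ c1 c2) _.
  - by rewrite mulr_ge0.
  - by rewrite invr_ge0 exprn_ge0// ltW.
  rewrite -mulrA -exprMn ler_wpM2l// lerXn2r ?nnegrE ?invr_ge0//.
    by rewrite divr_ge0 ?sqr_ge0// mulr_ge0.
  have r8 : 8 * `|q0| <= rho by rewrite /rho lerDl.
  have rr : rho <= rho ^+ 2 by rewrite expr2 ler_peMl// ltW.
  by rewrite ler_pdivrMr ?exprn_gt0//; lra.
rewrite -mulr_sumr mulrC -!mulrA ler_pM ?sumr_ge0//.
- by rewrite mulr_ge0 ?mulr_ge0 ?expR_ge0.
- exact: sum_expr_half_le.
- by rewrite le_eqVlt; apply/orP; left; apply/eqP; ring.
Qed.

(* For [k] large, [s - k] and the Laplace integral of [amp q0] over the whole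
   half-line are the same Catalan series; the error comes from cutting at [a]. *)
Lemma amp_laplace q0 a k s : 0 < a -> 0 < Re k -> 0 < Re s ->
  s ^+ 2 = k ^+ 2 + q0%:C -> 8 * `|q0| + 1 <= normc (2 * k) ->
  8 * `|q0| <= normc k ^+ 2 ->
  `|q0| * (2 * normc k / Re k + 2) <= normc k ^+ 2 ->
  normc (s - k - wintegral a (amp q0) (fun t => cexp (t%:C * - (2 * k)))) <=
  2 * `|q0| * expR (a * (8 * `|q0| + 1)) * expR (- (2 * a * Re k)).
Proof.
move=> a0 k0 s0 sE k8 k32 kC; set z := 2 * k.
have kn0 : 0 < normc k by apply: lt_le_trans k0 (le_trans (ler_norm _) (normRe_le_normc k)).
have k_neq0 : k != 0 by rewrite -normc_gt0.
have z0 : z != 0 by rewrite mulf_neq0// pnatr_eq0.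
have Rez : Re z = 2 * Re k by rewrite /z mulr_natl mulr2n ReImE mulr_natl mulr2n.
have sk : Re k <= normc (s + k).
  apply: le_trans (normRe_le_normc _); rewrite ReImE.
  by apply: le_trans (ler_norm _); rewrite lerDr ltW.
have sk0 : s + k != 0 by rewrite -normc_gt0; exact: lt_le_trans sk.
have nz : normc z = 2 * normc k by rewrite normcM (normc_natr R 2).
(* Since q0 = (s - k) (s + k), this [c] solves c = 1 + x c^2 and s - k = (q0 / z) c. Positivity of
   Re s gives |s + k| >= Re k, hence the bound [C]. *)
pose c := z / (s + k); pose x := - q0%:C / z ^+ 2; pose C := 2 * normc k / Re k.
have nx : normc x = `|q0| / (4 * normc k ^+ 2).
  by rewrite /x normcM normcN normcR normcV normcX nz exprMn -natrX.
have cE : c = 1 + x * c ^+ 2.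
  have q0E : q0%:C = s ^+ 2 - k ^+ 2 by rewrite sE; ring.
  by rewrite /c /x q0E /z; field; rewrite k_neq0 sk0.
have cC : normc c <= C.
  rewrite /c normcM normcV nz ler_wpM2l ?mulr_ge0 ?normc_ge0//.
  by rewrite lef_pV2 ?posrE ?(lt_le_trans k0 sk).
have k20 : 0 < 4 * normc k ^+ 2 by rewrite mulr_gt0// exprn_gt0.
have x32 : 32 * normc x <= 1 by rewrite nx mulrA ler_pdivrMr//; lra.
have x4 : 4 * (normc x * (C + 2)) <= 1.
  by rewrite nx mulrAC mulrA ler_pdivrMr// /C; lra.
have skE : s - k = q0%:C / z * c.
  have q0E : q0%:C = s ^+ 2 - k ^+ 2 by rewrite sE; ring.
  by rewrite /c q0E /z; field; rewrite k_neq0 sk0.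
set B := (leRHS); apply/ler_addgt0Pr => e e0.
have ez0 : 0 < e / 2 by rewrite divr_gt0.
have n1 := @amp_poly_wintegral_cvg q0 a _ _ (ltW a0) ez0 (ccontinuous_cexp (- z)).
have : (fun K : nat => normc (q0%:C / z) * ((C + 1) * 2^-1 ^+ K)) @ \oo --> (0 : R).
  rewrite -[X in _ --> X](mulr0 (normc (q0%:C / z) * (C + 1))).
  under eq_fun do rewrite mulrA.
  apply: cvgM; first exact: cvg_cst.
  by apply: cvg_expr; rewrite ger0_norm// invf_lt1// ltr1n.
move=> /cvgrPdist_lt/(_ _ ez0) n2.
have : \forall K \near \oo, normc (s - k - wintegral a (amp q0)
    (fun t => cexp (t%:C * - z))) <= B + e.
  near=> K.
  have h1 : normc (wintegral a (amp_poly q0 K) (fun t => cexp (t%:C * - z)) -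
    wintegral a (amp q0) (fun t => cexp (t%:C * - z))) < e / 2 by near: K.
  have h2 : `|0 - normc (q0%:C / z) * ((C + 1) * 2^-1 ^+ K)| < e / 2 by near: K.
  rewrite sub0r normrN in h2; have {}h2 := le_lt_trans (ler_norm _) h2.
  have h3 := @wintegral_amp_poly_tail q0 a z K a0 k8.
  rewrite Rez mulrA [a * 2]mulrC -/B in h3.
  have h4 := ler_wpM2l (normc_ge0 (q0%:C / z)) (catalan_poly_cvg K cE cC x32 x4).
  rewrite -normcM mulrBr -skE in h4.
  move: h1 h3 h4; set W := wintegral _ (amp_poly _ _) _; set W' := wintegral _ _ _.
  set P := q0%:C / z * _ => h1 h3 h4.
  have -> : s - k - W' = (s - k - P) + (P - W) + (W - W') by ring.
  apply: le_trans (le_normcD _ _) _; have := le_normcD (s - k - P) (P - W).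
  lra.
by move=> /filter_ex[].
Unshelve. all: by end_near. Qed.

End LaplaceTransform.

(** * Taylor polynomials of the exponential *)

Section TaylorCexp.
Variable R : realType.
Implicit Types (t x : R) (z w : R[i]).

Lemma primitive_normr_le (f df : R -> R) (C : R) n :
  (forall t, is_derive t 1 f (df t)) -> f 0 = 0 ->
  (forall t, 0 <= t <= 1 -> `|df t| <= C * t ^+ n) ->
  forall t, 0 <= t <= 1 -> `|f t| <= C * t ^+ n.+1 / n.+1%:R.
Proof.
move=> fdf f0 dfC.
have n0 : n.+1%:R != 0 :> R by rewrite pnatr_eq0.
have key (g dg : R -> R) : (forall t, is_derive t 1 g (dg t)) -> g 0 = 0 ->
    (forall t, 0 <= t <= 1 -> `|dg t| <= C * t ^+ n) ->
    forall t, 0 <= t <= 1 -> g t <= C * t ^+ n.+1 / n.+1%:R.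
  move=> gdg g0 dgC t /andP[t0 t1]; rewrite -subr_ge0.
  pose h t := C * t ^+ n.+1 / n.+1%:R - g t.
  have dh x : is_derive x 1 h (C * x ^+ n - dg x).
    have dX := is_derive_expn n x; have dgx := gdg x.
    by apply: is_derive_eq; rewrite /GRing.scale /=; field.
  have ch : {within `[0, t], continuous h}.
    apply: derivable_within_continuous => x _.
    by have := dh x => ?; exact: ex_derive.
  have [c] := @MVT_segment _ h (fun x => C * x ^+ n - dg x) 0 t t0 (fun x _ => dh x) ch.
  rewrite in_itv /= => /andP[c0 ct].
  have -> : h 0 = 0 by rewrite /h g0 exprS mul0r mulr0 mul0r subr0.
  rewrite !subr0 -/(h t) => ->.
  rewrite mulr_ge0// subr_ge0; apply: le_trans (ler_norm _) (dgC _ _).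
  by rewrite c0 (le_trans ct).
move=> t t01; rewrite ler_norml; apply/andP; split; last exact: (key f df).
rewrite lerNl; apply: (key (fun t => - f t) (fun t => - df t)) => //.
- by rewrite f0 oppr0.
- by move=> x x01; rewrite normrN; exact: dfC.
Qed.

Definition exp_poly z n t : R[i] := \sum_(k < n) z ^+ k / k`!%:R * (t ^+ k)%:C.

Lemma cder_exp_poly z n t : cder (exp_poly z n.+1) t (z * exp_poly z n t).
Proof.
rewrite /exp_poly; elim: n => [|n ih].
  under [X in cder X]eq_fun do rewrite big_ord_recl big_ord0 /= !expr0 addr0.
  by rewrite big_ord0 mulr0; exact: cder_cst.
under [X in cder X]eq_fun do rewrite big_ord_recr /=.
rewrite [in z * _]big_ord_recr /= mulrDr; apply: cderD; first exact: ih.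
apply: cder_eq (cderZ _ (cderR (is_derive_expn n t))).
have n0 : n`!%:R != 0 :> R[i] by rewrite pnatr_eq0 -lt0n fact_gt0.
have n1 : n.+1%:R != 0 :> R[i] by rewrite pnatr_eq0.
rewrite factS natrM exprS rmorphM (rmorph_nat (real_complex R)).
by field; rewrite n0 addrC natr1 n1.
Qed.

(** Along t z the remainder of order m + 1 has derivative z times the remainder of order m. Each
    integration treats real and imaginary parts separately and costs a factor 2, whence (2
    |z|)^n. *)
Lemma cexp_taylor z n :
  normc (cexp z - \sum_(k < n) z ^+ k / k`!%:R) <=
  expR (normc z) * ((2 * normc z) ^+ n / n`!%:R).
Proof.
pose r n t := cexp (t%:C * z) + -1 * exp_poly z n t.
have dr m t : cder (r m.+1) t (z * r m t).
  apply: cder_eq (cderD (cder_cexp z t) (cderZ (-1) (cder_exp_poly z m t))).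
  by rewrite /r; ring.
have r0 m : r m.+1 0 = 0.
  rewrite /r mul0r cexp0 /exp_poly big_ord_recl /= !expr0 fact0 divr1 mul1r.
  rewrite big1 ?addr0 ?mulN1r ?subrr// => k _.
  by rewrite /bump add1n [0 ^+ k.+1]exprS mul0r rmorph0 mulr0.
have key m t : 0 <= t <= 1 ->
    normc (r m t) <= expR (normc z) * (2 * normc z) ^+ m * t ^+ m / m`!%:R.
  elim: m t => [|m ih] t t01.
    rewrite !expr0 fact0 divr1 !mulr1 /r /exp_poly big_ord0 mulr0 addr0 normc_cexp.
    rewrite ler_expR ReImE /= mul0r subr0; apply: le_trans (ler_norm _) _.
    rewrite normrM; case/andP: t01 => t0 t1; rewrite (ger0_norm t0).
    by apply: le_trans (normRe_le_normc z); rewrite ler_piMl.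
  set C := normc z * (expR (normc z) * (2 * normc z) ^+ m / m`!%:R).
  have dC x : 0 <= x <= 1 -> normc (z * r m x) <= C * x ^+ m.
    move=> /ih h; rewrite normcM /C -mulrA ler_wpM2l ?normc_ge0//.
    by rewrite mulrAC.
  have h1 := @primitive_normr_le (fun x => Re (r m.+1 x)) (fun x => Re (z * r m x))
    C m (fun x => (dr m x).1) (congr1 (@complex.Re R) (r0 m))
    (fun x x01 => le_trans (normRe_le_normc _) (dC x x01)) t t01.
  have h2 := @primitive_normr_le (fun x => Im (r m.+1 x)) (fun x => Im (z * r m x))
    C m (fun x => (dr m x).2) (congr1 (@complex.Im R) (r0 m))
    (fun x x01 => le_trans (normIm_le_normc _) (dC x x01)) t t01.
  apply: le_trans (normc_le_normRe_normIm _) _.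
  apply: le_trans (lerD h1 h2) _; rewrite le_eqVlt; apply/orP; left; apply/eqP.
  have m0 : m`!%:R != 0 :> R by rewrite pnatr_eq0 -lt0n fact_gt0.
  have m1 : m.+1%:R != 0 :> R by rewrite pnatr_eq0.
  rewrite /C factS natrM [(2 * normc z) ^+ m.+1]exprS.
  by field; rewrite m0 addrC natr1 m1.
have := key n 1; rewrite ler01 lexx => /(_ isT).
rewrite expr1n mulr1 -mulrA; apply: le_trans.
rewrite /r mul1r mulN1r le_eqVlt; apply/orP; left; apply/eqP; congr (normc (_ - _)).
by apply: eq_bigr => k _; rewrite expr1n mulr1.
Qed.
End TaylorCexp.

(** * Growth on circles *)

Section RootsOfUnity.
Variable R : realType.

Lemma complex_prim_root_exists N : (0 < N)%N -> exists z : R[i], N.-primitive_root z.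
Proof.
move=> N0; have [r Dp] := closed_field_poly_normal ('X^N - 1 : {poly R[i]}).
rewrite (monicP _) ?monicXnsubC // scale1r in Dp.
have rN1 : all N.-unity_root r by apply/allP=> z; rewrite -root_prod_XsubC -Dp.
have sz_r : (N < (size r).+1)%N.
  by rewrite -(size_prod_XsubC r id) -Dp size_XnsubC.
have [|z] := hasP (has_prim_root N0 rN1 _ sz_r); last by exists z.
by rewrite -separable_prod_XsubC -Dp separable_Xn_sub_1 // pnatr_eq0 -lt0n.
Qed.

(** Discrete mean value property: the powers of z^k sum to zero for 0 < k < N, and the size
    condition excludes exponents that are nonzero multiples of N. *)
Lemma sum_prim_root_horner N (z : R[i]) (p : {poly R[i]}) :
  N.-primitive_root z -> (size p <= N)%N ->
  \sum_(j < N) p.[z ^+ j] = N%:R * p`_0.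
Proof.
move=> pz sp; under eq_bigr do rewrite (horner_coef_wide _ sp).
rewrite exchange_big /=.
have N0 : (0 < N)%N := prim_order_gt0 pz.
have sumz (k : 'I_N) : \sum_(j < N) p`_k * (z ^+ j) ^+ k =
    if k == 0%N :> nat then N%:R * p`_0 else 0.
  rewrite -mulr_sumr; case: eqP => [->|/eqP k0].
    by under eq_bigr do rewrite expr0; rewrite sumr_const card_ord mulrC.
  under eq_bigr do rewrite exprAC.
  have zk1 : z ^+ k != 1.
    rewrite -(prim_order_dvd pz); apply: contra k0 => /dvdn_leq h.
    rewrite -leqn0 leqNgt; apply/negP => /h.
    by rewrite leqNgt ltn_ord.
  have : (z ^+ k - 1) * \sum_(j < N) (z ^+ k) ^+ j = 0.
    by rewrite -subrX1 exprAC (prim_expr_order pz) expr1n subrr.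
  move/eqP; rewrite mulf_eq0 subr_eq0 (negbTE zk1) /= => /eqP ->.
  by rewrite mulr0.
rewrite (eq_bigr _ (fun k _ => sumz k)) -big_mkcond /=.
by rewrite (big_pred1 (Ordinal N0)).
Qed.

(* The constant coefficient is the mean of the values at the roots of unity. *)
Lemma normc_coef0_le (p : {poly R[i]}) (B : R) :
  (forall w : R[i], normc w = 1 -> normc p.[w] <= B) -> normc p`_0 <= B.
Proof.
move=> pB; pose N := (size p).+1.
have [z pz] := complex_prim_root_exists (ltn0Sn (size p)).
have N0 : 0 < N%:R :> R by rewrite ltr0n.
rewrite -(ler_pM2l N0) -[X in X * normc _]normc_natr -normcM.
rewrite -(sum_prim_root_horner pz (leqnSn _)).
apply: le_trans (normc_sum _ _ _) _.
rewrite mulr_natl -[X in _ *+ X]card_ord -sumr_const; apply: ler_sum => j _.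
apply: pB; apply: (normc_unit (ltn0Sn (size p))).
by rewrite exprAC (prim_expr_order pz) expr1n.
Qed.

(** On the unit circle 1 - w^2 = - 2 i (Im w) w, so the weight measures the distance to the real
    axis. *)
Lemma normc_1sub_sqr (w : R[i]) : normc w = 1 -> normc (1 - w ^+ 2) = 2 * `|Im w|.
Proof.
move=> w1; have w2 : Re w ^+ 2 + Im w ^+ 2 = 1 by rewrite -normc_sqr w1 expr1n.
have -> : 1 - w ^+ 2 = (0 +i* (- (2 * Im w))) * w.
  apply: complex_ext; rewrite expr2 !ReImE /=; last by ring.
  by rewrite -[X in X + _]w2; ring.
rewrite normcM w1 mulr1 /= expr0n add0r sqrtr_sqr normrN normrM.
by rewrite ger0_norm.
Qed.

(** The condition - Im k <= Re k keeps the argument above - pi / 4, which also settles the lower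
    edge of the sector because atan c < pi / 4. *)
Lemma mem_sector (k : R[i]) (c : R) : 0 < c -> 0 < Re k ->
  c * Re k < - Im k -> - Im k <= Re k -> sector (atan c) k.
Proof.
move=> c0 x0 cx yx; set x := Re k in x0 cx yx *; set y := - Im k in cx yx *.
pose v := y / x.
have cv : c < v by rewrite /v ltr_pdivlMr.
have v1 : v <= 1 by rewrite /v ler_pdivrMr// mul1r.
have a1 : atan v <= pi / 4 by rewrite -atan1; exact: le_atan.
have a2 : atan c < atan v by exact: lt_atan.
have p0 := pi_gt0 R.
exists (normc k), (- atan v); split.
- by rewrite normc_gt0; apply: contraTneq x0 => k0; rewrite /x k0 ltxx.
- by lra.
- by rewrite ltrN2.
- rewrite cosN sinN.
  have sv : sin (atan v) = v * cos (atan v).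
    have cv0 : cos (atan v) != 0.
      by rewrite gt_eqF// cos_gt0_pihalf// atan_gtNpi2 atan_ltpi2.
    by rewrite -[v in v * _]atanK /tan mulfVK.
  have nk : normc k = x * Num.sqrt (1 + v ^+ 2).
    apply/eqP; rewrite -(eqrXn2 (n := 2)) ?normc_ge0 ?mulr_ge0 ?sqrtr_ge0 ?ltW//.
    rewrite exprMn sqr_sqrtr; last by rewrite addr_ge0 ?sqr_ge0.
    rewrite normc_sqr -/x /v /y; apply/eqP; field.
    by rewrite gt_eqF.
  have s0 : Num.sqrt (1 + v ^+ 2) != 0.
    by rewrite gt_eqF// sqrtr_gt0 ltr_wpDr ?sqr_ge0.
  rewrite sv cos_atan nk.
  apply: complex_ext; rewrite ReImE /= !mul0r ?subr0 ?addr0.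
    by rewrite -/x; field.
  by rewrite -[LHS]opprK -/y /v; field; rewrite s0 gt_eqF.
Qed.

End RootsOfUnity.

(** * Exponential moments as an entire function *)

Section ExponentialKernel.
Variables (R : realType) (a : R) (b : R -> R).
Local Notation mu := (@lebesgue_measure R).
Hypotheses (a0 : 0 < a) (ib : mu.-integrable `]0, a[ (EFin \o b)).
Implicit Types (k w : R[i]) (r rho t : R).

(** The factor exp(2 a k) is included so that a remainder of order exp(- 2 a k) becomes
    subexponential. *)
Definition exp_kernel a k (t : R) : R[i] := cexp ((2 * (a - t))%:C * k).

Lemma exp_kernelE k t :
  exp_kernel a k t = cexp ((2 * a)%:C * k) * cexp (t%:C * - (2 * k)).
Proof.
rewrite /exp_kernel -cexpD; congr cexp.
by rewrite mulrBr rmorphB !rmorphM (rmorph_nat (real_complex R)); ring.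
Qed.

Lemma ccontinuous_exp_kernel k : ccontinuous (exp_kernel a k).
Proof.
have -> : exp_kernel a k =
    fun t => cexp ((2 * a)%:C * k) * cexp (t%:C * - (2 * k)).
  by apply/funext => t; exact: exp_kernelE.
by apply: ccontinuousZ; exact: ccontinuous_cexp.
Qed.

Local Notation E k := (wintegral a b (exp_kernel a k)).
Local Notation C := (2 * (\int[mu]_(t in `]0, a[) `|b t|)).

Lemma wintegral_weight_ge0 : 0 <= C.
Proof. by rewrite mulr_ge0// Rintegral_ge0. Qed.

Lemma normc_exp_kernel_le k t : t \in `]0, a[ -> 0 <= Re k ->
  normc (exp_kernel a k t) <= expR (2 * a * Re k).
Proof.
move=> t0a k0; have /andP[t0 ta] : 0 < t < a by move: t0a; rewrite in_itv.
rewrite /exp_kernel normc_cexp ReImE /= mul0r subr0.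
by rewrite ler_expR ler_wpM2r// ler_pM2l//; lra.
Qed.

Lemma wintegral_exp_kernel_le k : 0 <= Re k -> normc (E k) <= C * expR (2 * a * Re k).
Proof.
move=> k0; apply: normc_wintegral_le => //.
- exact: ltW.
- exact: ccontinuous_exp_kernel.
- by move=> t t0; exact: normc_exp_kernel_le.
Qed.

(** Because [b] is real, bounds below the real axis transfer to the upper half-plane. *)
Lemma wintegral_exp_kernel_conj k : E (k^*) = (E k)^*.
Proof.
rewrite -wintegral_conj ?ltW//; last exact: ccontinuous_exp_kernel.
apply: eq_wintegral => t _; rewrite /exp_kernel -cexp_conj; congr cexp.
by apply: complex_ext; case: k => x y /=; ring.
Qed.

(** Taylor polynomial in w of the moment at r + rho w, obtained by expanding the exponential under
    the integral; its value at w = 0 is the moment at the centre. *)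
Definition kernel_taylor r rho n : {poly R[i]} :=
  \poly_(j < n) wintegral a b
    (fun t => ((2 * (a - t) * rho) ^+ j / j`!%:R)%:C * exp_kernel a r%:C t).

Lemma kernel_taylor_error r rho n w : 0 <= r -> 0 <= rho -> normc w = 1 ->
  normc (E (r%:C + rho%:C * w) - (kernel_taylor r rho n).[w]) <=
  C * (expR (2 * a * r) * (expR (2 * a * rho) * ((4 * a * rho) ^+ n / n`!%:R))).
Proof.
move=> r0 rho0 w1.
pose G (j : nat) t := w ^+ j *
  (((2 * (a - t) * rho) ^+ j / j`!%:R)%:C * exp_kernel a r%:C t).
have cpart j : ccontinuous
    (fun t => ((2 * (a - t) * rho) ^+ j / j`!%:R)%:C * exp_kernel a r%:C t).
  apply: ccontinuousM; last exact: ccontinuous_exp_kernel.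
  apply: ccontinuousR => t; apply: cvgM; last exact: cvg_cst.
  apply: (@continuous_comp _ _ _ (fun t => 2 * (a - t) * rho) (fun x => x ^+ j)).
    apply: cvgM; last exact: cvg_cst.
    apply: cvgM; first exact: cvg_cst.
    by apply: cvgB; [exact: cvg_cst|exact: cvg_id].
  exact: exprn_continuous.
have cG j : ccontinuous (G j) by exact: ccontinuousZ.
have cS : ccontinuous (fun t => \sum_(j < n) G j t) by exact: ccontinuous_sum.
have -> : (kernel_taylor r rho n).[w] = wintegral a b (fun t => \sum_(j < n) G j t).
  rewrite wintegral_sum ?(ltW a0)// horner_poly; apply: eq_bigr => j _.
  by rewrite wintegralZ ?(ltW a0)// mulrC.
rewrite -[X in _ - X]mul1r -mulNr -wintegralZ ?(ltW a0)//.
rewrite -wintegralD ?(ltW a0)//; [|exact: ccontinuous_exp_kernel|exact: ccontinuousZ].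
apply: normc_wintegral_le; rewrite ?(ltW a0)//.
- by apply: ccontinuousD; [exact: ccontinuous_exp_kernel|exact: ccontinuousZ].
- by rewrite !mulr_ge0 ?expR_ge0 ?invr_ge0 ?exprn_ge0// !mulr_ge0// ltW.
move=> t t0a; have /andP[t0 ta] : 0 < t < a by move: t0a; rewrite in_itv.
pose z := (2 * (a - t) * rho)%:C * w.
have at0 : 0 <= 2 * (a - t) by rewrite mulr_ge0// subr_ge0 ltW.
have nz : normc z = 2 * (a - t) * rho.
  by rewrite normcM w1 mulr1 normcR ger0_norm// mulr_ge0.
have nza : normc z <= 2 * a * rho.
  by rewrite nz ler_wpM2r// ler_pM2l//; lra.
have -> : exp_kernel a (r%:C + rho%:C * w) t + -1 * \sum_(j < n) G j t =
    exp_kernel a r%:C t * (cexp z - \sum_(j < n) z ^+ j / j`!%:R).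
  rewrite mulrBr mulN1r; congr (_ - _).
    rewrite /exp_kernel -cexpD; congr cexp.
    by rewrite /z mulrDr [(2 * (a - t) * rho)%:C]rmorphM mulrA.
  rewrite mulr_sumr; apply: eq_bigr => j _.
  have fE (x : R) : (x / j`!%:R)%:C = x%:C / j`!%:R.
    by rewrite rmorphM fmorphV (rmorph_nat (real_complex R)).
  have zE : z ^+ j = ((2 * (a - t) * rho) ^+ j)%:C * w ^+ j.
    by rewrite /z exprMn -rmorphXn.
  by rewrite /G fE zE; ring.
rewrite normcM; apply: ler_pM; rewrite ?normc_ge0//.
  by have := @normc_exp_kernel_le r%:C t t0a r0.
apply: le_trans (cexp_taylor z n) _; apply: ler_pM.
- exact: expR_ge0.
- by rewrite divr_ge0// exprn_ge0// mulr_ge0// normc_ge0.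
- by rewrite ler_expR.
- rewrite ler_wpM2r ?invr_ge0// lerXn2r ?nnegrE ?mulr_ge0 ?normc_ge0 ?(ltW a0)//.
  lra.
Qed.

Lemma kernel_taylor_coef0 r rho n : (kernel_taylor r rho n.+1)`_0 = E r%:C.
Proof.
rewrite coef_poly /=; apply: eq_wintegral => t _.
by rewrite expr0 fact0 divr1 rmorph1 mul1r.
Qed.

(* Maximum principle on the circle of centre [r] and radius [rho] for the entire
   function [E] times a power of [1 - w ^+ 2], which is [1] at the centre and
   small near the two real points of the circle. *)
Lemma wintegral_exp_kernel_circle r rho m (B : R) : 0 <= r -> 0 <= rho ->
  (forall w, normc w = 1 ->
    normc (E (r%:C + rho%:C * w)) * normc (1 - w ^+ 2) ^+ m <= B) ->
  normc (E r%:C) <= B.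
Proof.
move=> r0 rho0 hB.
(* Taylor error times 2^m, the maximum of the weight on the circle; [m] stays fixed while n tends to
   infinity. *)
pose err n := C * (expR (2 * a * r) * (expR (2 * a * rho) *
  exp_coeff (4 * a * rho) n)) * 2 ^+ m.
have step n : normc (E r%:C) <= B + err n.+1.
  pose p := kernel_taylor r rho n.+1 * (1 - 'X^2) ^+ m.
  have -> : E r%:C = p`_0.
    rewrite /p coefM big_ord_recl big_ord0 addr0 /= subn0 kernel_taylor_coef0.
    by rewrite -horner_coef0 horner_exp !hornerE expr0n /= subr0 expr1n mulr1.
  apply: normc_coef0_le => w w1.
  have qw : (1 - 'X^2 : {poly R[i]}).[w] = 1 - w ^+ 2 by rewrite !hornerE.
  rewrite /p hornerM horner_exp qw normcM normcX.
  have h1 := kernel_taylor_error n.+1 r0 rho0 w1.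
  have h2 := hB w w1.
  have q2 : normc (1 - w ^+ 2) ^+ m <= 2 ^+ m.
    rewrite lerXn2r ?nnegrE ?normc_ge0//; apply: le_trans (le_normc_sub _ _) _.
    by rewrite normc1 normcX w1 expr1n.
  have q0 : 0 <= normc (1 - w ^+ 2) ^+ m by rewrite exprn_ge0// normc_ge0.
  set K := normc (kernel_taylor _ _ _).[w].
  have h3 : K <= normc (E (r%:C + rho%:C * w)) +
      normc (E (r%:C + rho%:C * w) - (kernel_taylor r rho n.+1).[w]).
    rewrite addrC -normc_distC; apply: le_trans _ (le_normcD _ _).
    by rewrite addrC addrA [X in X - _]addrC addrK.
  apply: le_trans (ler_wpM2r q0 h3) _; rewrite mulrDl; apply: lerD => //.
  rewrite /err; apply: le_trans (ler_wpM2r q0 h1) _.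
  rewrite ler_wpM2l// mulr_ge0 ?wintegral_weight_ge0// !mulr_ge0 ?expR_ge0//.
  by rewrite ?invr_ge0 ?exprn_ge0// !mulr_ge0// ltW.
have err0 : err n @[n --> \oo] --> 0.
  rewrite /err -[X in _ --> X](mul0r (2 ^+ m)); apply: cvgM; last exact: cvg_cst.
  rewrite -[X in _ --> X](mulr0 C); apply: cvgM; first exact: cvg_cst.
  rewrite -[X in _ --> X](mulr0 (expR (2 * a * r))).
  apply: cvgM; first exact: cvg_cst.
  rewrite -[X in _ --> X](mulr0 (expR (2 * a * rho))).
  by apply: cvgM; [exact: cvg_cst|exact: cvg_exp_coeff].
apply/ler_addgt0Pr => e e0.
move/cvgrPdist_lt : err0 => /(_ _ e0).
move=> [N _ hN]; have := hN N.+1 (leqnSn N).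
rewrite /= sub0r normrN => /(le_lt_trans (ler_norm _)) h.
by apply: le_trans (step N) _; rewrite lerD2l ltW.
Qed.

End ExponentialKernel.

(** * Vanishing of a density with small exponential moments *)

Section RealAxis.
Variables (R : realType) (a : R) (b : R -> R).
Local Notation mu := (@lebesgue_measure R).
Hypotheses (a0 : 0 < a) (ib : mu.-integrable `]0, a[ (EFin \o b)).
Local Notation E k := (wintegral a b (exp_kernel a k)).
Local Notation C := (2 * (\int[mu]_(t in `]0, a[) `|b t|)).

Hypothesis sector_growth : forall e eta : R, 0 < e -> 0 < eta -> exists M : R,
  forall k : R[i], sector e k -> M < normc k -> normc (E k) <= expR (eta * normc k).

(** Here Re k <= 3 r / 2, so the trivial bound is of order exp(3 a r). The weight is at most exp(- 3
    a / delta) to a power n > delta r - 1, which cancels exp(3 a r) up to a constant. *)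
Lemma circle_bound_near_axis (r delta : R) (w : R[i]) (n : nat) :
  0 < delta -> 0 <= r -> normc w = 1 -> delta * r < n.+1%:R ->
  2 * `|Im w| <= expR (- (3 * a / delta)) ->
  normc (E (r%:C + (r / 2)%:C * w)) * (2 * `|Im w|) ^+ n <=
  C * expR (3 * a / delta).
Proof.
move=> d0 r0 w1 nr Imw.
have Rew : `|Re w| <= 1 by rewrite -w1 normRe_le_normc.
have ReE : Re (r%:C + (r / 2)%:C * w) = r + r / 2 * Re w.
  by rewrite !ReImE /= mul0r subr0.
move: Rew; rewrite ler_norml => /andP[Rew1 Rew2].
have Re1 : Re (r%:C + (r / 2)%:C * w) <= 3 / 2 * r by rewrite ReE; nra.
have Re0 : 0 <= Re (r%:C + (r / 2)%:C * w) by rewrite ReE; nra.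
have h1 := wintegral_exp_kernel_le a0 ib Re0.
have C0 := wintegral_weight_ge0 a b.
have h2 : (2 * `|Im w|) ^+ n <= expR (- (3 * a * r) + 3 * a / delta).
  apply: (@le_trans _ _ (expR (- (3 * a / delta)) ^+ n)).
    by rewrite lerXn2r ?nnegrE ?mulr_ge0 ?expR_ge0.
  rewrite -expRM_natr ler_expR.
  have -> : - (3 * a * r) + 3 * a / delta = - (3 * a / delta) * (delta * r - 1).
    by field; rewrite gt_eqF.
  rewrite -natr1 in nr.
  by rewrite !mulNr lerN2 ler_wpM2l ?divr_ge0 ?mulr_ge0 ?(ltW a0) ?(ltW d0)//; lra.
apply: (@le_trans _ _ (C * expR (2 * a * (3 / 2 * r)) *
    expR (- (3 * a * r) + 3 * a / delta))).
  apply: ler_pM; rewrite ?normc_ge0 ?exprn_ge0 ?mulr_ge0//.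
  apply: le_trans h1 _; rewrite ler_wpM2l// ler_expR ler_wpM2l//.
  by rewrite mulr_ge0// ltW.
rewrite -mulrA -expRD le_eqVlt; apply/orP; left; apply/eqP; congr (_ * expR _).
by field; rewrite gt_eqF.
Qed.

Lemma real_axis_growth (eta : R) : 0 < eta -> exists M : R,
  forall r : R, M < r -> normc (E r%:C) <= expR (eta * r).
Proof.
(* Off the axis |k| <= 3 r / 2 yields exp(3 delta r / 2) and the weight at most exp(delta r): a rate
   of 5 delta / 2 in all, below [eta]. *)
move=> eta0; pose delta := eta / 3.
have d0 : 0 < delta by rewrite divr_gt0.
(* For |Im w| <= sg the weight 2 |Im w| is at most exp(- 3 a / delta), as the near-axis bound
   requires. *)
pose sg : R := expR (- (3 * a / delta)) / 2.
have sg0 : 0 < sg by rewrite divr_gt0// expR_gt0.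
have sg1 : sg <= 1 / 2.
  rewrite ler_pM2r// -expR0 ler_expR oppr_le0.
  by rewrite divr_ge0 ?mulr_ge0 ?ltW.
(* On the remaining arcs |Im k| > r sg / 2 while Re k <= 3 r / 2, hence a slope above sg / 3. *)
pose c := sg / 3; have c0 : 0 < c by rewrite divr_gt0.
have ec0 : 0 < atan c by rewrite -(atan0 R) lt_atan.
have [M hM] := sector_growth ec0 d0.
pose K := C * expR (3 * a / delta).
have K0 : 0 <= K by rewrite mulr_ge0 ?expR_ge0// (wintegral_weight_ge0 a b).
(* The first threshold puts the whole circle, where |k| >= r / 2, beyond [M]; the second gives K <
   eta r <= exp(eta r). *)
exists (Num.max (2 * `|M|) (K / eta)) => r.
rewrite gt_max => /andP[rM rK].
have r0 : 0 < r by apply: le_lt_trans rM; rewrite mulr_ge0.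
pose n := Num.truncn (delta * r).
have /andP[n1 n2] := truncn_itv (mulr_ge0 (ltW d0) (ltW r0)).
rewrite -/n in n1 n2.
apply: (@wintegral_exp_kernel_circle _ _ _ a0 ib r (r / 2) n); rewrite ?divr_ge0 ?(ltW r0)//.
move=> w w1; rewrite normc_1sub_sqr//.
have [near|far] := leP (2 * `|Im w|) (2 * sg).
  apply: (@le_trans _ _ K).
    apply: circle_bound_near_axis => //; first exact: ltW.
    by rewrite (le_trans near)// /sg mulrC divfK.
  rewrite ltr_pdivrMr// in rK; rewrite mulrC in rK.
  by apply: le_trans (ltW rK) (le_trans _ (expR_ge1Dx _)); rewrite lerDr.
have Imw1 : `|Im w| <= 1 by rewrite -w1 normIm_le_normc.
have Rew1 : `|Re w| <= 1 by rewrite -w1 normRe_le_normc.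
have key (v : R[i]) : normc v = 1 -> sg < - Im v ->
    normc (E (r%:C + (r / 2)%:C * v)) <= expR (3 / 2 * delta * r).
  move=> v1 Imv; set k := _ + _.
  have Rek : Re k = r + r / 2 * Re v by rewrite !ReImE /= mul0r subr0.
  have Imk : Im k = r / 2 * Im v by rewrite !ReImE /= mul0r addr0 add0r.
  have := normRe_le_normc v; rewrite v1 ler_norml => /andP[Rev1 Rev2].
  have := normIm_le_normc v; rewrite v1 ler_norml => /andP[Imv1 _].
  have p1 : r * Re v <= r by rewrite ler_piMr// ltW.
  have p2 : - r <= r * Re v by rewrite -mulrN1 ler_wpM2l// ltW.
  have p3 : r * sg < r * - Im v by rewrite ltr_pM2l.
  have p4 : r * - Im v <= r by rewrite ler_piMr ?(ltW r0)//; lra.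
  have p5 : sg * (r * Re v) <= sg * r by rewrite ler_pM2l.
  have ck : normc k <= 3 / 2 * r.
    apply: le_trans (le_normcD _ _) _; rewrite normcM v1 !normcR.
    by rewrite !ger0_norm ?divr_ge0 ?(ltW r0)//; lra.
  have ck2 : `|M| < normc k.
    apply: lt_le_trans (le_trans (ler_norm _) (normRe_le_normc k)).
    by rewrite Rek; lra.
  apply: le_trans (hM k _ (le_lt_trans (ler_norm M) ck2)) _.
    apply: mem_sector => //.
    - by rewrite Rek; lra.
    - by rewrite Rek Imk /c; lra.
    - by rewrite Rek Imk; lra.
  have p6 : delta * normc k <= delta * (3 / 2 * r) by rewrite ler_pM2l.
  by rewrite ler_expR; lra.
have h1 : normc (E (r%:C + (r / 2)%:C * w)) <= expR (3 / 2 * delta * r).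
  have [Imw|Imw] := leP 0 (Im w); last first.
    by apply: key => //; move: far; rewrite ltr0_norm//; lra.
  rewrite -normc_conj -wintegral_exp_kernel_conj//.
  have -> : (r%:C + (r / 2)%:C * w)^* = r%:C + (r / 2)%:C * w^*.
    by apply: complex_ext; case: (w) => x y /=; ring.
  apply: key; first by rewrite normc_conj.
  have -> : Im w^* = - Im w by case: (w).
  by move: far; rewrite ger0_norm//; lra.
have h2 : (2 * `|Im w|) ^+ n <= expR (delta * r).
  apply: (@le_trans _ _ (expR 1 ^+ n)).
    rewrite lerXn2r ?nnegrE ?expR_ge0 ?mulr_ge0//.
    by apply: le_trans _ (expR_ge1Dx 1); lra.
  by rewrite -expRM_natr ler_expR mul1r.
apply: le_trans (ler_pM _ _ h1 h2) _; rewrite ?normc_ge0 ?exprn_ge0 ?mulr_ge0//.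
have er : 0 < eta * r by rewrite mulr_gt0.
by rewrite -expRD ler_expR /delta; lra.
Qed.

End RealAxis.

(** * Polynomial approximation of a step *)

Section Cutoff.
Variable R : realType.
Implicit Types (u v : R) (n m N : nat).

Lemma bin_le_expn n m : ('C(n, m) <= n ^ m)%N.
Proof.
apply: (@leq_trans ('C(n, m) * m`!)%N); first by rewrite leq_pmulr// fact_gt0.
rewrite bin_ffact; elim: m n => [|m ih] n; first by rewrite ffactn0 expn0.
rewrite ffactnSr expnSr; apply: leq_mul => //; exact: leq_subr.
Qed.

Lemma bernoulli_le (v : R) n : 0 <= v <= 1 -> 1 - n%:R * v <= (1 - v) ^+ n.
Proof.
move=> /andP[v0 v1]; elim: n => [|n ih]; first by rewrite mul0r subr0 expr0.
have v1' : 0 <= 1 - v by rewrite subr_ge0.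
rewrite exprS -natr1; apply: le_trans (ler_wpM2l v1' ih).
have n0 : 0 <= n%:R * v * v by rewrite !mulr_ge0.
nra.
Qed.

(* [1 - (1 - u / N) ^+ N] is a polynomial without constant term in [u] that is
   close to [0] for small [u] and close to [1] for large [u <= N]. *)
Definition cutoff (N : nat) (u : R) : R := 1 - (1 - u / N%:R) ^+ N.

Lemma cutoff_range N u : (0 < N)%N -> 0 <= u <= N%:R -> 0 <= cutoff N u <= 1.
Proof.
move=> N0 /andP[u0 uN]; have n0 : 0 < N%:R :> R by rewrite ltr0n.
have v : 0 <= 1 - u / N%:R <= 1.
  rewrite subr_ge0 ler_pdivrMr// mul1r uN /= gerBl divr_ge0//.
case/andP: v => v0 v1.
by rewrite /cutoff subr_ge0 exprn_ile1//= gerBl exprn_ge0.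
Qed.

Lemma cutoff_le N u : (0 < N)%N -> 0 <= u <= N%:R -> cutoff N u <= u.
Proof.
move=> N0 /andP[u0 uN]; have n0 : 0 < N%:R :> R by rewrite ltr0n.
have := @bernoulli_le (u / N%:R) N; rewrite divr_ge0// ler_pdivrMr// mul1r uN.
move=> /(_ isT); rewrite mulrC divfK ?gt_eqF// /cutoff; lra.
Qed.

(** From (1 - u / N)^N <= exp(- u) <= 1 / (1 + u); the rational bound is enough since u will be
    exponentially large. *)
Lemma cutoff_ge N u : (0 < N)%N -> 0 <= u <= N%:R -> 1 - (1 + u)^-1 <= cutoff N u.
Proof.
move=> N0 /andP[u0 uN]; have n0 : 0 < N%:R :> R by rewrite ltr0n.
rewrite /cutoff lerD2l lerN2.
apply: (@le_trans _ _ (expR (- u))).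
  have -> : - u = - (u / N%:R) * N%:R by rewrite mulNr divfK// gt_eqF.
  rewrite expRM_natr lerXn2r ?nnegrE ?expR_ge0//.
    by rewrite subr_ge0 ler_pdivrMr// mul1r.
  exact: expR_ge1Dx.
by rewrite expRN lef_pV2 ?posrE ?expR_gt0 ?expR_ge1Dx// ltr_pwDl.
Qed.

(** The coefficients are binomials over N^(m+1). Their bound must be uniform in [N], which will grow
    exponentially with the sampling point. *)
Lemma cutoff_expand N : (0 < N)%N -> exists2 c : 'I_N -> R,
  forall i, `|c i| <= 1 & forall u, cutoff N u = \sum_(m < N) c m * u ^+ m.+1.
Proof.
move=> N0; have n0 : N%:R != 0 :> R by rewrite pnatr_eq0 -lt0n.
exists (fun m => - ((-1) ^+ m.+1 * 'C(N, m.+1)%:R / N%:R ^+ m.+1)).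
  move=> m; rewrite normrN normrM normrM normrX normrN1 expr1n mul1r normfV.
  rewrite !ger0_norm ?exprn_ge0// ler_pdivrMr ?exprn_gt0 ?ltr0n// mul1r.
  by rewrite -natrX ler_nat bin_le_expn.
move=> u; rewrite /cutoff exprBn big_ord_recl /= expr0 !mulr1 expr1n bin0 mul1r.
rewrite opprD addrA subrr add0r -sumrN; apply: eq_bigr => m _.
rewrite /bump add1n expr1n mulr1 expr_div_n -mulr_natr.
by field; rewrite expf_neq0.
Qed.

Lemma cvg_geometric_bound (f : nat -> R) (l q : R) : 0 <= q < 1 ->
  (\forall k \near \oo, `|l - f k| <= 2 * q ^+ k) -> f @ \oo --> l.
Proof.
move=> /andP[q0 q1] h; apply/cvgrPdist_lt => e e0.
have e20 : 0 < e / 2 by rewrite divr_gt0.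
have /cvgrPdist_lt/(_ _ e20) n : (fun k => q ^+ k) @ \oo --> (0 : R).
  by apply: cvg_expr; rewrite ger0_norm.
near=> k; have h1 : `|l - f k| <= 2 * q ^+ k by near: k.
have : `|0 - q ^+ k| < e / 2 by near: k.
rewrite sub0r normrN => /(le_lt_trans (ler_norm _)) h2.
by apply: le_lt_trans h1 _; lra.
Unshelve. all: by end_near. Qed.

End Cutoff.

(** * From moments at real points to vanishing *)

Section Mikusinski.
Variables (R : realType) (a : R) (b : R -> R).
Local Notation mu := (@lebesgue_measure R).
Hypotheses (a0 : 0 < a) (ib : mu.-integrable `]0, a[ (EFin \o b)).
Local Notation E k := (wintegral a b (exp_kernel a k)).

Hypothesis growth : forall eta : R, 0 < eta -> exists M : R,
  forall r : R, M < r -> normc (E r%:C) <= expR (eta * r).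

(** The integral of [b] against the cutoff of exp(2 k (y - t)) has two limits. Expanded into moments
    it is at most a geometric series tending to 0; by dominated convergence it tends to the integral
    of [b] up to y. *)
Lemma integral_initial0 (y : R) : 0 < y < a ->
  \int[mu]_(t in `]0, y]) b t = 0.
Proof.
move=> /andP[y0 ya]; pose x := a - y; have x0 : 0 < x by rewrite subr_gt0.
(* Since y - t <= a for t > 0, this choice keeps u / N in [0, 1]. *)
pose N (k : nat) := (Num.truncn (expR (2 * a * k%:R))).+1.
have N0 k : (0 < N k)%N by [].
pose u (k : nat) t := expR (2 * k%:R * (y - t)).
have uN k t : 0 < t -> 0 <= u k t <= (N k)%:R.
  move=> t0; rewrite expR_ge0 /=.
  have /andP[_ /ltW] := truncn_itv (expR_ge0 (2 * a * k%:R)).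
  apply: le_trans; rewrite ler_expR.
  have : k%:R * (y - t) <= k%:R * a by rewrite ler_wpM2l//; lra.
  by lra.
pose phi k t := cutoff (N k) (u k t).
have cphi k : continuous (phi k).
  move=> t; apply: cvgB; first exact: cvg_cst.
  apply: (@continuous_comp _ _ _ (fun t => 1 - u k t / (N k)%:R) (fun z => z ^+ N k)).
    apply: cvgB; first exact: cvg_cst.
    apply: cvgM; last exact: cvg_cst.
    apply: (@continuous_comp _ _ _ (fun t => 2 * k%:R * (y - t)) expR).
      apply: cvgM; first exact: cvg_cst.
      by apply: cvgB; [exact: cvg_cst|exact: cvg_id].
    exact: continuous_expR.
  exact: exprn_continuous.
(* With x = a - y, the moment at r carries the factor exp(- 2 r x); growth at rate x still leaves
   exp(- r x), and r = k (m + 1) makes these terms geometric with ratio exp(- x k). *)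
have [M hM] := growth x0.
have ex1 : 0 <= expR (- x) < 1 by rewrite expR_ge0 expR_lt1 oppr_lt0.
have lim0 : \int[mu]_(t in `]0, a[) (b t * phi k t) @[k --> \oo] --> (0 : R).
  apply: (cvg_geometric_bound ex1).
  have /cvgrPdist_lt half : (fun k => expR (- x) ^+ k) @ \oo --> (0 : R).
    by apply: cvg_expr; case/andP: ex1 => ? ?; rewrite ger0_norm.
  have {}half := half (1 / 2) ltac:(lra).
  near=> k.
  have kM : M < k%:R by near: k; exact: nbhs_infty_gtr.
  have : `|0 - expR (- x) ^+ k| < 1 / 2 by near: k.
  rewrite sub0r normrN => /(le_lt_trans (ler_norm _)) q2.
  set q := expR (- x) ^+ k in q2 *.
  have q0 : 0 <= q by rewrite exprn_ge0// expR_ge0.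
  have qE : q = expR (- (x * k%:R)) by rewrite /q -expRM_natr mulNr.
  have [c c1 cE] := cutoff_expand R (N0 k).
  pose r m : R := k%:R * m.+1%:R.
  have phiE t : (phi k t)%:C = \sum_(m < N k)
      (c m * expR (- (2 * r m * x)))%:C * exp_kernel a (r m)%:C t.
    rewrite /phi cE rmorph_sum; apply: eq_bigr => m _.
    have -> : exp_kernel a (r m)%:C t = (expR (2 * (a - t) * r m))%:C.
      apply: complex_ext; rewrite /exp_kernel /cexp !ReImE /= !mulr0 !mul0r.
        by rewrite !addr0 subr0 cos0 mulr1.
      by rewrite !addr0 sin0 mulr0.
    have -> : c m * u k t ^+ m.+1 =
        c m * expR (- (2 * r m * x)) * expR (2 * (a - t) * r m).
      rewrite -[RHS]mulrA -expRD /u -expRM_natr; congr (_ * expR _).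
      by rewrite /r /x; ring.
    by rewrite rmorphM.
  have Tphi : wintegral a b (fun t => (phi k t)%:C) =
      \sum_(m < N k) (c m * expR (- (2 * r m * x)))%:C * E (r m)%:C.
    have ck m := @ccontinuous_exp_kernel R a (r m)%:C.
    rewrite -(eq_wintegral b (fun t _ => esym (phiE t))).
    rewrite wintegral_sum ?(ltW a0)//; last by move=> m; exact: ccontinuousZ.
    by apply: eq_bigr => m _; rewrite wintegralZ ?(ltW a0).
  rewrite sub0r normrN.
  apply: (@le_trans _ _ (normc (wintegral a b (fun t => (phi k t)%:C)))).
    by apply: le_trans (normRe_le_normc _); rewrite wintegralE.
  rewrite Tphi; apply: le_trans (normc_sum _ _ _) _.
  apply: (@le_trans _ _ (\sum_(m < N k) q * 2^-1 ^+ m)); last first.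
    by rewrite -mulr_sumr mulrC ler_wpM2r// sum_expr_half_le.
  apply: ler_sum => m _; rewrite normcM normcR normrM [`|expR _|]ger0_norm ?expR_ge0//.
  have rM : M < r m.
    by apply: lt_le_trans kM _; rewrite /r ler_peMr// ler1n.
  have h1 := ler_pM (mulr_ge0 (normr_ge0 (c m)) (expR_ge0 _)) (normc_ge0 _)
    (ler_piMl (expR_ge0 (- (2 * r m * x))) (c1 m)) (hM _ rM).
  apply: le_trans h1 _; rewrite -expRD.
  have -> : - (2 * r m * x) + x * r m = - (x * k%:R) * m.+1%:R by rewrite /r; ring.
  rewrite expRM_natr -qE exprS ler_wpM2l// lerXn2r ?nnegrE//; lra.
have lim1 : \int[mu]_(t in `]0, a[) (b t * phi k t) @[k --> \oo] -->
    \int[mu]_(t in `]0, a[) (b \_ `]0, y[) t.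
  have iby : mu.-integrable `]0, a[ (EFin \o (b \_ `]0, y[)).
    rewrite -restrict_EFin; apply/integrable_restrict => //.
    by apply: integrableS ib => //; exact: measurableI.
  apply: fine_cvg; rewrite fineK; last exact: integrable_fin_num.
  have [||||||_ _] := @dominated_convergence _ _ _ mu `]0, a[ _
    (fun k t => (b t * phi k t)%:E) (fun t => ((b \_ `]0, y[) t)%:E)
    (fun t => `|b t|%:E).
  - by [].
  - by move=> k; have /integrableP[] := integrableM_continuous (ltW a0) ib (cphi k).
  - by have /integrableP[] := iby.
  - exists [set y]; split; [by []|exact: lebesgue_measure_set1|].
    move=> t /= h; apply: contrapT => ty; apply: h => t0a.
    have /andP[t0 ta] : 0 < t < a by move: t0a; rewrite in_itv.
    apply: cvg_EFin; first by near=> k.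
    have cst_b : (fun=> b t) @ \oo --> b t by exact: cvg_cst.
    have geo (l d : R) : 0 < d ->
        (forall k, `|l - phi k t| <= expR (- (2 * d * k%:R))) -> phi ^~ t @ \oo --> l.
      move=> d0 hl; have e1 : 0 <= expR (- (2 * d)) < 1.
        by rewrite expR_ge0 expR_lt1 oppr_lt0 mulr_gt0.
      apply: (cvg_geometric_bound e1); apply: nearW => k.
      apply: le_trans (hl k) _; rewrite -mulNr expRM_natr.
      by rewrite ler_peMl ?exprn_ge0 ?expR_ge0// ler1n.
    have [ty'|ty'|//] := ltgtP t y.
    - rewrite patchE mem_set /=; last by rewrite in_itv/= t0.
      rewrite -[X in _ --> X]mulr1; apply: cvgM => //.
      apply: (geo _ (y - t)); first by rewrite subr_gt0.
      move=> k; have /andP[p0 p1] := cutoff_range (N0 k) (uN k t t0).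
      rewrite ger0_norm ?subr_ge0//.
      have := cutoff_ge (N0 k) (uN k t t0) => h2.
      have h3 : (1 + u k t)^-1 <= expR (- (2 * (y - t) * k%:R)).
        rewrite expRN lef_pV2 ?posrE ?ltr_wpDr ?expR_gt0 ?expR_ge0//.
        by rewrite /u mulrAC lerDr.
      by apply: le_trans h3; rewrite /phi; lra.
    - rewrite patchE memNset /=; last first.
        by rewrite in_itv /= t0 /=; apply/negP; rewrite -leNgt ltW.
      rewrite -[X in _ --> X](mulr0 (b t)); apply: cvgM => //.
      apply: (geo _ (t - y)); first by rewrite subr_gt0.
      move=> k; have /andP[p0 p1] := cutoff_range (N0 k) (uN k t t0).
      rewrite sub0r normrN ger0_norm//.
      apply: le_trans (cutoff_le (N0 k) (uN k t t0)) _.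
      by rewrite /u le_eqVlt; apply/orP; left; apply/eqP; congr expR; ring.
  - exact: integrable_norm.
  - apply: aeW => t k /= t0a; have /andP[t0 ta] : 0 < t < a by move: t0a; rewrite in_itv.
    have /andP[p0 p1] := cutoff_range (N0 k) (uN k t t0).
    by rewrite lee_fin normrM ler_piMr// ger0_norm.
  - by [].
have := cvg_unique _ lim0 lim1.
rewrite -Rintegral_mkcondl (_ : `]0, y[ `&` `]0, a[ = `]0, y[)%classic; last first.
  by apply/setIidl; apply: subset_itvl; rewrite bnd_simp ltW.
move=> /(_ (@Rhausdorff R) _)/esym h0.
rewrite -Rintegral_itv_bndo_bndc//; apply: integrableS ib => //.
by apply: subset_itvl; rewrite bnd_simp ltW.
Unshelve. all: by end_near. Qed.

(** The primitive of [b] vanishes in a neighbourhood of y, and its derivative there is b y. *)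
Lemma continuous_eq0 (y : R) : 0 < y < a -> {for y, continuous b} -> b y = 0.
Proof.
move=> /andP[y0 ya] cb; pose v := (y + a) / 2.
have yv : y < v by rewrite /v; lra.
have va : v < a by rewrite /v; lra.
have iv : mu.-integrable `]0, v] (EFin \o b).
  by apply: integrableS ib => //; apply: subset_itvl; rewrite bnd_simp.
have [dF <-] := @continuous_FTC1 R b (BRight 0) y v yv iv y0 cb.
rewrite derive1E (near_eq_derive (g := cst 0)) ?derive_cst//.
near=> z; apply: integral_initial0.
by apply/andP; split; near: z; [exact: lt_nbhsr|exact: lt_nbhsl].
Unshelve. all: by end_near. Qed.

End Mikusinski.

(** * Uniqueness of the amplitude *)

Section AmplitudeUniqueness.
Variable R : realType.
Implicit Types (q A : R -> R) (k s : R[i]) (a e t : R).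
Local Notation mu := (@lebesgue_measure R).

(** The ratio |k| / Re k is thus bounded on the sector, and since Re k > 0 > Im k the square of k is
    not real, which permits a root of k^2 + q0 with positive real part. *)
Lemma sector_Re_Im e k : 0 < e -> sector e k ->
  [/\ 0 < sin e, sin e * normc k <= Re k & Im k < 0].
Proof.
move=> e0 [r [t [r0 t1 t2 ->]]]; have p2 := pi_ge2 R.
have se : 0 < sin e by apply: sin_gt0_pi; apply/andP; split; lra.
have nk : normc (r%:C * (cos t +i* sin t)) = r.
  by rewrite normcM normcR /= cos2Dsin2 sqrtr1 mulr1 gtr0_norm.
rewrite nk !ReImE /= !mul0r subr0 addr0; split => //.
  rewrite mulrC ler_pM2l// -cosBpihalf -cosN -[leRHS]cosN ltW// opprB.
  by rewrite ltr_cos ?in_itv/=; try (apply/andP; split); lra.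
by rewrite pmulr_rlt0// -oppr_gt0 -sinN sin_gt0_pi//; apply/andP; split; lra.
Qed.

(** The limit in [tildeO] is used only to make the modulus eventually less than 1, with |g|^eta =
    exp(- 2 a eta Re k). *)
Lemma tildeO_exp_bound e a eta (f : R[i] -> R[i]) : 0 < eta ->
  tildeO (within (sector e) (@cinfty R)) f (fun k => cexp (- (2 * a)%:C * k)) ->
  exists M : R, forall k, sector e k -> M < normc k ->
    normc (f k) * expR (2 * a * Re k) <= expR (2 * a * Re k * eta).
Proof.
move=> eta0 [_ /(_ eta eta0)/cvg_normcP/(_ 1 ltr01)[M hM]].
exists M => k ks Mk; have := hM k Mk ks.
have -> : normc (cexp (- (2 * a)%:C * k)) = expR (- (2 * a * Re k)).
  by rewrite normc_cexp !ReImE /= oppr0 mul0r subr0 mulNr.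
rewrite subr0 !normcM normcV normc_cexp normcR (ger0_norm (powR_ge0 _ _)).
have -> : Re (- (2 * a)%:C * k) = - (2 * a * Re k).
  by rewrite !ReImE /= oppr0 mul0r subr0 mulNr.
rewrite -expRM mulNr !expRN invrK => /ltW.
by rewrite ler_pdivrMr ?expR_gt0// mul1r.
Qed.

Lemma amplitude_continuous q A (q0 : R) :
  (forall x, 0 <= x -> q x = q0) ->
  {within `[0, +oo[, continuous (fun x => A x - q x)} ->
  (forall y, 0 < y -> {for y, continuous A}) /\ A x @[x --> 0^'+] --> A 0.
Proof.
move=> hq /continuous_within_itvcyP [cA cA0].
have Aq x : 0 <= x -> A x = A x - q x + q0 by move=> x0; rewrite hq// subrK.
split=> [y y0|].
- have cy : (fun x => A x - q x + q0) x @[x --> y] --> A y.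
    rewrite [X in _ --> X](Aq y) ?ltW//; apply: cvgD; last exact: cvg_cst.
    by apply: cA; rewrite in_itv /= y0.
  apply: cvg_trans cy; apply: near_eq_cvg; near=> x.
  by rewrite /= -Aq// ltW//; near: x; exact: lt_nbhsr.
- have c0 : (fun x => A x - q x + q0) x @[x --> 0^'+] --> A 0.
    by rewrite [X in _ --> X](Aq 0)//; apply: cvgD; [exact: cA0|exact: cvg_cst].
  apply: cvg_trans c0; apply: near_eq_cvg; near=> x.
  by rewrite /= -Aq// ltW//; near: x; exact: nbhs_right_gt.
Unshelve. all: by end_near. Qed.

Lemma amplitude_growth q A (q0 a e eta : R) :
  (forall x, 0 <= x -> q x = q0) -> is_A_amplitude q A -> 0 < a -> 0 < e -> 0 < eta ->
  exists M : R, forall k, sector e k -> M < normc k ->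
    normc (wintegral a (fun t => A t - amp q0 t) (exp_kernel a k)) <=
    expR (eta * normc k).
Proof.
move=> hq [iA tA _] a0 e0 eta0.
(* Then 2 a d Re k = (eta / 2) Re k, half of the allowed rate; the other half absorbs the constant
   [C]. *)
pose d := eta / (4 * a); have d0 : 0 < d by rewrite divr_gt0// mulr_gt0.
have [M hM] := tildeO_exp_bound d0 (tA a e a0 e0).
pose C := 2 * `|q0| * expR (a * (8 * `|q0| + 1)).
have C0 : 0 <= C by rewrite mulr_ge0 ?expR_ge0// mulr_ge0.
have q00 : 0 <= `|q0| by [].
pose S := `|q0| * (2 / sin e + 2).
(* Beyond this radius the size conditions of [amp_laplace] hold on the whole sector, [S] bounding
   |q0| (2 |k| / Re k + 2), and 1 + C <= 1 + eta n / 2 <= exp(eta n / 2). *)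
exists (`|M| + 1 + 8 * `|q0| + `|S| + 2 * C / eta) => k ks kM.
have [se Rek Imk] := sector_Re_Im e0 ks.
have S0 : 0 <= `|S| by []. have M0 : 0 <= `|M| by [].
have Ce : 0 <= 2 * C / eta by rewrite divr_ge0 ?(ltW eta0)// mulr_ge0.
set n := normc k in Rek kM *.
have n1 : 1 < n by lra.
have n0 : 0 < n by lra.
have nn : n <= n ^+ 2 by rewrite expr2 ler_peMl// ltW.
have Rek0 : 0 < Re k by apply: lt_le_trans Rek; rewrite mulr_gt0.
have [s sE s0] : exists2 s : R[i], s ^+ 2 = k ^+ 2 + q0%:C & 0 < Re s.
  apply: sqrt_pos_Re; rewrite expr2 !ReImE /= addr0 lt_eqF//.
  have : Re k * Im k < 0 by rewrite pmulr_rlt0.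
  lra.
have mE : weyl_m q (- k ^+ 2) = - s.
  by apply: (weyl_m_cst hq s0); rewrite sE; ring.
have nM : M < n by have := ler_norm M; lra.
have := hM k ks nM; rewrite mE -/n.
set I := cintegral _ _ _.
have IE : I = wintegral a A (fun t => cexp (t%:C * - (2 * k))).
  rewrite /I /wintegral; congr cintegral; apply/funext => t; congr (_ * cexp _).
  by rewrite rmorphM (rmorph_nat (real_complex R)); ring.
move=> hf.
have lap : normc (s - k - wintegral a (amp q0) (fun t => cexp (t%:C * - (2 * k))))
    <= C * expR (- (2 * a * Re k)).
  apply: amp_laplace => //.
  - by rewrite normcM (normc_natr R 2) -/n; lra.
  - by rewrite -/n; lra.
  - rewrite -/n; apply: le_trans nn; apply: le_trans (_ : S <= n).
      rewrite /S ler_wpM2l// lerD2r -mulrA ler_wpM2l//.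
      by rewrite ler_pdivrMr// mulrC ler_pdivlMr// mulrC.
    by apply: le_trans (ler_norm S) _; lra.
(* The unknown s - k is common to both asymptotics and cancels, leaving the two remainders. *)
have EE : wintegral a (fun t => A t - amp q0 t) (exp_kernel a k) =
    cexp ((2 * a)%:C * k) * ((- s - (- k - I)) +
      (s - k - wintegral a (amp q0) (fun t => cexp (t%:C * - (2 * k))))).
  have iamp := continuous_integrable_oo a (@amp_continuous R q0).
  rewrite wintegralBl ?(ltW a0)//; last 2 first.
  - exact: iA.
  - exact: ccontinuous_exp_kernel.
  have ext : exp_kernel a k =
      fun t => cexp ((2 * a)%:C * k) * cexp (t%:C * - (2 * k)).
    by apply/funext => t; exact: exp_kernelE.
  rewrite ext !wintegralZ ?(ltW a0)//; try exact: ccontinuous_cexp; last exact: iA.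
  by rewrite IE; ring.
rewrite EE normcM normc_cexp ReImE /= mul0r subr0.
set X := expR (2 * a * Re k * d) in hf.
have X1 : 1 <= X.
  by rewrite /X -expR0 ler_expR ltW// mulr_gt0// mulr_gt0// mulr_gt0.
have e1 : 0 <= expR (2 * a * Re k) by exact: expR_ge0.
apply: le_trans (ler_wpM2l e1 (le_normcD _ _)) _.
rewrite mulrDr.
have h2 : expR (2 * a * Re k) *
    normc (s - k - wintegral a (amp q0) (fun t => cexp (t%:C * - (2 * k)))) <= C.
  apply: le_trans (ler_wpM2l e1 lap) _.
  by rewrite mulrCA -expRD subrr expR0 mulr1.
rewrite mulrC in hf; apply: le_trans (lerD hf h2) _.
have X2 : X <= expR (eta / 2 * n).
  rewrite /X ler_expR (_ : 2 * a * Re k * d = eta / 2 * Re k); last first.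
    by rewrite /d; field; rewrite gt_eqF.
  by rewrite ler_pM2l ?divr_gt0// (le_trans (ler_norm _))// normRe_le_normc.
have C2 : 1 + C <= expR (eta / 2 * n).
  apply: le_trans (expR_ge1Dx _); rewrite lerD2l.
  have h : 2 * C / eta <= n by lra.
  rewrite ler_pdivrMr// in h; lra.
have -> : eta * n = eta / 2 * n + eta / 2 * n by field.
rewrite expRD; apply: le_trans (ler_pM _ _ X2 C2); [nra|lra|lra].
Qed.

Lemma amplitude_cst q A (q0 : R) :
  (forall x, 0 <= x -> q x = q0) -> is_A_amplitude q A ->
  forall y, 0 < y -> A y = amp q0 y.
Proof.
(* Any cut-off beyond y would do; the vanishing lemma needs y strictly inside. *)
move=> hq hA y y0; pose a := y + 1.
have a0 : 0 < a by rewrite addr_gt0.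
have [iA _ cA] := hA.
have iamp := continuous_integrable_oo a (@amp_continuous R q0).
have ib : mu.-integrable `]0, a[ (EFin \o (fun t => A t - amp q0 t)).
  by have := integrableB _ (iA a a0) iamp; exact.
apply/eqP; rewrite -subr_eq0; apply/eqP.
apply: (continuous_eq0 a0 ib (b := fun t => A t - amp q0 t)).
- apply: real_axis_growth => // e eta e0 eta0.
  exact: (amplitude_growth hq hA).
- by rewrite y0 /a ltrDl ltr01.
- apply: cvgB; last exact: amp_continuous.
  by have [h _] := amplitude_continuous hq cA; exact: h.
Qed.

End AmplitudeUniqueness.

(** * Bessel forms of the amplitude *)

Section Bessel.
Variable R : realType.

(** With s^2 = q0, multiplying the series in a^2 by a / s gives the odd powers of a s in the
    order-one Bessel series, term by term; convergence is inherited from the amplitude. *)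
Lemma amp_besselJ (q0 a : R) : 0 < q0 -> 0 < a ->
  Num.sqrt q0 / a * besselJ 1 (2 * a * Num.sqrt q0) = amp q0 a.
Proof.
move=> q00 a0; set s := Num.sqrt q0.
have s0 : 0 < s by rewrite sqrtr_gt0.
have s2 : q0 = s ^+ 2 by rewrite sqr_sqrtr// ltW.
have : (fun n => a / s * amp_poly q0 n a) @ \oo --> a / s * amp q0 a.
  by apply: cvgM; [exact: cvg_cst|exact: amp_poly_cvg].
rewrite (_ : (fun n => _) = series (fun k : nat =>
    (-1) ^+ k / (k`! * (k + 1)`!)%:R * (2 * a * s / 2) ^+ (2 * k + 1))).
  move=> /(cvg_lim (@Rhausdorff R)); rewrite /besselJ => ->.
  by field; rewrite !gt_eqF.
apply/funext => n; rewrite amp_polyE mulr_sumr /series /= big_mkord.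
apply: eq_bigr => k _; rewrite /amp_coef !addn1.
have k0 : (k`! * k.+1`!)%:R != 0 :> R by rewrite pnatr_eq0 -lt0n muln_gt0 !fact_gt0.
rewrite (_ : 2 * a * s / 2 = a * s); last by field.
rewrite exprMn [a ^+ (2 * k).+1]exprS [s ^+ (2 * k).+1]exprS.
have -> : q0 ^+ k.+1 = s ^+ (2 * k).+2 by rewrite s2 -exprM mulnS add2n.
rewrite [s ^+ (2 * k).+2]exprS [s ^+ (2 * k).+1]exprS.
move: ((k`! * k.+1`!)%:R) k0 => f k0.
by field; rewrite k0 gt_eqF.
Qed.

Lemma amp_besselI (q0 a : R) : q0 < 0 -> 0 < a ->
  - (Num.sqrt (- q0) / a * besselI 1 (2 * a * Num.sqrt (- q0))) = amp q0 a.
Proof.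
move=> q00 a0; set s := Num.sqrt (- q0).
have s0 : 0 < s by rewrite sqrtr_gt0 oppr_gt0.
have s2 : q0 = - s ^+ 2 by rewrite sqr_sqrtr ?opprK// oppr_ge0 ltW.
have : (fun n => - (a / s) * amp_poly q0 n a) @ \oo --> - (a / s) * amp q0 a.
  by apply: cvgM; [exact: cvg_cst|exact: amp_poly_cvg].
rewrite (_ : (fun n => _) = series (fun k : nat =>
    (k`! * (k + 1)`!)%:R^-1 * (2 * a * s / 2) ^+ (2 * k + 1))).
  move=> /(cvg_lim (@Rhausdorff R)); rewrite /besselI => ->.
  by field; rewrite !gt_eqF.
apply/funext => n; rewrite amp_polyE mulr_sumr /series /= big_mkord.
apply: eq_bigr => k _; rewrite /amp_coef !addn1.
have k0 : (k`! * k.+1`!)%:R != 0 :> R by rewrite pnatr_eq0 -lt0n muln_gt0 !fact_gt0.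
rewrite (_ : 2 * a * s / 2 = a * s); last by field.
have -> : q0 ^+ k.+1 = (-1) ^+ k.+1 * s ^+ (2 * k).+2.
  have -> : q0 = -1 * s ^+ 2 by rewrite mulN1r.
  by rewrite exprMn -exprM mulnS add2n.
rewrite [(-1) ^+ k.+1]exprS.
(* The sign from q0^(k+1) cancels the alternating one up to a single - 1, hence the modified
   function and the minus sign in front. *)
have sgn : (-1) ^+ k * (-1) ^+ k = 1 :> R by rewrite -exprMn mulrNN mulr1 expr1n.
rewrite exprMn [a ^+ (2 * k).+1]exprS [s ^+ (2 * k).+1]exprS.
rewrite [s ^+ (2 * k).+2]exprS [s ^+ (2 * k).+1]exprS.
move: ((k`! * k.+1`!)%:R) k0 => f k0.
by rewrite -[RHS]mul1r -[X in _ = X * _]sgn; field; rewrite k0 gt_eqF.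
Qed.

End Bessel.

Theorem theorem10p1 (R : realType) (q0 : R) (q A : R -> R)
    (hq : forall x : R, 0 <= x -> q x = q0) (hA : is_A_amplitude q A) :
  (0 < q0 ->
     let F := fun a : R =>
       Num.sqrt q0 / a * besselJ 1 (2 * a * Num.sqrt q0) in
     (forall a : R, 0 < a -> A a = F a) /\ F a @[a --> 0^'+] --> A 0) /\
  (q0 < 0 ->
     let F := fun a : R =>
       - (Num.sqrt (- q0) / a * besselI 1 (2 * a * Num.sqrt (- q0))) in
     (forall a : R, 0 < a -> A a = F a) /\ F a @[a --> 0^'+] --> A 0).
Proof.
have [_ _ cA] := hA; have [_ A0] := amplitude_continuous hq cA.
have key (F : R -> R) : (forall a, 0 < a -> F a = amp q0 a) ->
    (forall a : R, 0 < a -> A a = F a) /\ F a @[a --> 0^'+] --> A 0.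
  move=> FE; have AF a : 0 < a -> A a = F a.
    by move=> a0; rewrite FE// (amplitude_cst hq hA).
  (* The value at 0 is reached through right continuity of [A], inherited from A - q and the
     constancy of [q]. *)
  split=> //; apply: cvg_trans A0; apply: near_eq_cvg; near=> a.
  by apply: AF; near: a; exact: nbhs_right_gt.
by split=> h /=; apply: key => a a0; [exact: amp_besselJ|exact: amp_besselI].
Unshelve. all: by end_near. Qed.
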